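(* Let $G$ be a finite simple graph embeddable in the torus or in the Klein bottle, and let $R\subseteq E(G)$. Suppose that no cycle of $G$ has $R$-length equal to 3, 4, or 6, and that no two cycles of $G$ of $R$-length 5 share exactly one edge. Then for every 5-list-assignment $L$ of $G$, there exists a proper $L$-coloring $f$ of $G$ such that for every vertex $v$ of $G$ that is not $R$-relaxed, some color appears an odd number of times among the colors $f(u)$, $u\in N(v)$.
   Context: For a cycle $C$ of $G$, its $R$-length is $|E(C)|+|E(C)\cap R|$. A vertex $v$ of $G$ is $R$-relaxed if its degree is odd, or its degree is $0$, or $v$ is incident with an edge of $R$. A 5-list-assignment of $G$ is a family $L=(L_v : v\in V(G))$ of sets with $|L_v|=5$ for every vertex $v$; an $L$-coloring is a function $f$ with $f(v)\in L_v$ for all $v$, and it is proper if $f(u)\neq f(v)$ for every edge $uv$. ''Some color appears an odd number of times on $N(v)$'' means there is a color $c$ such that $|\{u\in N(v): f(u)=c\}|$ is odd. *)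

(* Defs.v *)
From HB Require Import structures.
From mathcomp Require Import all_boot all_order all_algebra finmap.
From mathcomp Require Import generic_quotient.
From mathcomp Require Import all_classical all_reals topology normedtype.

Set Implicit Arguments.
Unset Strict Implicit.
Unset Printing Implicit Defensive.

Import Order.TTheory GRing.Theory Num.Theory.
Import numFieldNormedType.Exports.

Local Open Scope classical_set_scope.
Local Open Scope ring_scope.

Record sgraph := SGraph {
  vertex :> finType;
  adj : rel vertex;
  adj_sym : symmetric adj;
  adj_irr : irreflexive adj }.

Section Graph.
Variable G : sgraph.
Implicit Types (v : G) (c : seq G) (R : {set {set G}}).

Definition edges : {set {set G}} :=
  [set [set p.1; p.2]%SET | p : G * G & adj p.1 p.2]%SET.

Definition nbhd v : {set G} := [set u | adj v u]%SET.

Definition degree v : nat := #|nbhd v|.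

(* A cycle of [G] is given by one of its cyclic vertex sequences. *)
Definition is_cycle c : bool := ucycleb (@adj G) c && (2 < size c)%N.

Definition cycle_edges c : {set {set G}} :=
  [set [set x; next c x]%SET | x in c]%SET.

Definition Rlength R c : nat :=
  (#|cycle_edges c| + #|cycle_edges c :&: R|%SET)%N.

Definition relaxed R v : bool :=
  [|| odd (degree v), degree v == 0%N | [exists e in R, v \in e]].

End Graph.

(* The torus is the quotient of the plane by the translations
   (x, y) |-> (x + m, y + n), m, n integers. *)
Section Torus.
Variable K : realType.

Definition torus_rel (p q : K * K) : bool :=
  `[< exists m n : int, q = (p.1 + m%:~R, p.2 + n%:~R) >].

Lemma torus_rel_refl : reflexive torus_rel.
Proof.
by move=> [x y]; apply/asboolP; exists 0, 0; rewrite /= !addr0.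
Qed.

Lemma torus_rel_sym : symmetric torus_rel.
Proof.
suff H p q : torus_rel p q -> torus_rel q p by move=> p q; apply/idP/idP; exact: H.
move=> /asboolP[m [n ->]]; apply/asboolP; exists (- m), (- n).
by case: p => x y /=; rewrite !mulrNz !addrK.
Qed.

Lemma torus_rel_trans : transitive torus_rel.
Proof.
move=> _ p _ /asboolP[m [n ->]] /asboolP[m' [n' ->]]; apply/asboolP.
by exists (m + m'), (n + n'); rewrite /= !intrD !addrA.
Qed.

Canonical torus_equiv :=
  EquivRel torus_rel torus_rel_refl torus_rel_sym torus_rel_trans.

Definition torus : topologicalType :=
  quotient_topology {eq_quot torus_equiv}%qT.

End Torus.

(* The Klein bottle is the quotient of the plane by the group generated by
   (x, y) |-> (x + 1, - y) and (x, y) |-> (x, y + 1), whose elements are the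
   maps (x, y) |-> (x + m, (-1)^m y + n), m, n integers. *)
Section Klein.
Variable K : realType.

Definition klein_rel (p q : K * K) : bool :=
  `[< exists m n : int, q = (p.1 + m%:~R, (-1) ^ m * p.2 + n%:~R) >].

Let sgn_int (m n : int) : exists k : int, (-1) ^ m * n%:~R = k%:~R :> K.
Proof.
exists ((-1) ^ m * n); rewrite intrM; congr (_ * _).
by rewrite [RHS]rmorphXz ?rmorphN1 ?unitrN1.
Qed.

Lemma klein_rel_refl : reflexive klein_rel.
Proof.
by move=> [x y]; apply/asboolP; exists 0, 0; rewrite /= expr0z mul1r !addr0.
Qed.

Lemma klein_rel_sym : symmetric klein_rel.
Proof.
suff H p q : klein_rel p q -> klein_rel q p by move=> p q; apply/idP/idP; exact: H.
move=> /asboolP[m [n ->]]; apply/asboolP.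
have [k kE] := sgn_int (- m) n; exists (- m), (- k).
case: p => x y /=; rewrite !mulrNz addrK mulrDr kE addrK mulrA -expfzDr.
  by rewrite addNr expr0z mul1r.
by rewrite oppr_eq0 oner_eq0.
Qed.

Lemma klein_rel_trans : transitive klein_rel.
Proof.
move=> _ p _ /asboolP[m [n ->]] /asboolP[m' [n' ->]]; apply/asboolP.
have [k kE] := sgn_int m' n; exists (m' + m), (k + n').
rewrite /= !intrD mulrDr kE mulrA -expfzDr ?oppr_eq0 ?oner_eq0//.
by rewrite (addrC m'%:~R) !addrA.
Qed.

Canonical klein_equiv :=
  EquivRel klein_rel klein_rel_refl klein_rel_sym klein_rel_trans.

Definition klein_bottle : topologicalType :=
  quotient_topology {eq_quot klein_equiv}%qT.

End Klein.

(* An embedding of [G] in [X]: distinct points [pt v] for the vertices and, for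
   each edge uv, a simple arc [arc u v] parametrized by [0, 1] from [pt u] to
   [pt v], whose interior avoids all vertices and the interiors of the arcs of
   all other edges. The arcs [arc u v] and [arc v u] of an edge are the same
   arc with opposite orientations. *)
Definition embeddable (K : realType) (G : sgraph) (X : topologicalType) : Prop :=
  exists (pt : G -> X) (arc : G -> G -> K -> X),
  [/\ injective pt,
      forall u v : G, adj u v ->
        [/\ {within `[0, 1], continuous (arc u v)},
            {in `[0, 1] &, injective (arc u v)},
            arc u v 0 = pt u /\ arc u v 1 = pt v &
            {in `[0, 1], forall t, arc v u t = arc u v (1 - t)}],
      forall (u v w : G) (t : K), adj u v -> t \in `]0, 1[ ->
        arc u v t <> pt w &
      forall (u v u' v' : G) (s t : K), adj u v -> adj u' v' ->
        s \in `]0, 1[ -> t \in `]0, 1[ ->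
        arc u v s = arc u' v' t -> [set u; v]%SET = [set u'; v']%SET].

(* Main.v *)
Require Import Defs.
From mathcomp Require Import all_boot all_order all_algebra finmap.
From mathcomp Require Import zify ring lra.

(** Cover the surface by a fine square grid. The cells met by an arc are
    connected, and disjoint arcs meet disjoint sets of cells, so [G] is a minor
    of the grid graph. Mod 2 linear algebra on the grid (whose Euler
    characteristic is 0) yields, for every such minor, a family of at least
    |E| - |V| even subgraphs covering every edge at most twice: they play the
    role of the faces. An even subgraph has R-length 5 or at least 7, and those
    of R-length 5 ("pentagons") are edge-disjoint, hence
    5 |E| <= 7 |V| + 2 |R| + 2 (number of pentagons).

    In a minimal counterexample a relaxed vertex of degree d has at least 5 - d
    neighbours that are not relaxed, since otherwise it could be deleted and
    coloured last: it has to avoid the colours of its neighbours and one further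
    colour for each neighbour that is not relaxed. A vertex of degree 2 that is
    not relaxed is suppressed, the new edge being put in R. Discharging then
    contradicts the inequality above. Edge sets are represented by symmetric sets
    of darts (ordered pairs), so that all cardinals and weights are doubled. *)

Set Implicit Arguments.
Unset Strict Implicit.
Unset Printing Implicit Defensive.
Import Order.TTheory GRing.Theory Num.Theory.

(** * Dart sets, even subgraphs and pentagons *)

Section Darts.
Variable V : finType.
Implicit Types (A O R : {set V * V}) (u v x y : V).

(** The arcs of an embedding are merely continuous, so no faces are at hand to be counted. On a grid
    everything is finite, and what counting faces would give survives as a statement about even edge
    sets. Boundaries of regions are only known to be even, not cycles; hence the length hypothesis
    is carried as a condition on even sets, and it passes through suppression in this form. Being a
    minor of the grid is also kept by deletion and suppression.

    Origin of the inequality: if at least [|E| - |V|] distinct nonempty even sets cover each edge at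
    most twice, their R-lengths add up to at most [2 |E| + 2 |R|]. Each is at least 7, except for a
    deficit of 2 at each of the [p] pentagons, so [7 (|E| - |V|) <= 2 |E| + 2 |R| + 2 p].

    Discharging works with multiples of 1/20: a vertex of degree [d] owns [50 d], its share of
    [100 |E|], and pays 140 for itself and the costs of its edges. The local bounds allow equality
    at degree 4 (not relaxed) and degree 3 (relaxed), so strictness needs a global argument: tight
    vertices cannot fit together around a pentagon with four edges. *)

Definition dnbr O v := [set u | (v, u) \in O].

Definition dsym O := forall x y, ((x, y) \in O) = ((y, x) \in O).

Definition even_sub A O : bool :=
  [&& O \subset A, [forall x, forall y, ((x, y) \in O) == ((y, x) \in O)] &
      [forall v, ~~ odd #|dnbr O v|]].

Lemma even_subP A O :
  reflect [/\ O \subset A, dsym O & forall v, ~~ odd #|dnbr O v|]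
          (even_sub A O).
Proof.
apply: (iffP and3P) => [[OA sO eO]|[OA sO eO]]; split => //.
- by move=> x y; apply/eqP; exact: (forallP (forallP sO x) y).
- exact/forallP.
- by apply/forallP => x; apply/forallP => y; rewrite sO.
- exact/forallP.
Qed.


Definition wt R O := #|O| + #|O :&: R|.

Definition relax A R v :=
  [|| odd #|dnbr A v|, #|dnbr A v| == 0 | dnbr R v != set0].

(** The constants 10 and 14 are the doubled [R]-lengths 5 and 7. *)
Definition sparse A R :=
  (forall O, even_sub A O -> O != set0 -> wt R O = 10 \/ 14 <= wt R O) /\
  (forall O1 O2, even_sub A O1 -> even_sub A O2 -> wt R O1 = 10 -> wt R O2 = 10 ->
    O1 != O2 -> [disjoint O1 & O2]).

Definition pentas A R := [set O | even_sub A O && (wt R O == 10)].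

Lemma card_uniq_ge (T : finType) (S : {set T}) (s : seq T) :
  uniq s -> {subset s <= S} -> size s <= #|S|.
Proof.
move=> us sS; rewrite -(card_uniqP us); apply: subset_leq_card.
exact/subsetP.
Qed.

Lemma card_darts O : #|O| = \sum_v #|dnbr O v|.
Proof.
rewrite -sum1_card (eq_bigl (fun p => (p.1, p.2) \in O)); last by case.
rewrite -(pair_big_dep predT (fun x y => (x, y) \in O) (fun _ _ => 1)) /=.
by apply: eq_bigr => v _; rewrite -sum1_card; apply: eq_bigl => u; rewrite inE.
Qed.

Lemma sum_darts O (F : V -> V -> nat) :
  \sum_(p in O) F p.1 p.2 = \sum_v \sum_(u in dnbr O v) F v u.
Proof.
rewrite (eq_bigl (fun p => (p.1, p.2) \in O)); last by case.
rewrite -(pair_big_dep predT (fun x y => (x, y) \in O) F) /=.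
by apply: eq_bigr => v _; apply: eq_bigl => u; rewrite inE.
Qed.

Lemma even_card A O : even_sub A O -> ~~ odd #|O|.
Proof.
case/even_subP => _ _ eO; rewrite card_darts.
by elim/big_rec: _ => // v n _ en; rewrite oddD negb_add (negbTE (eO v)) (negbTE en).
Qed.

Lemma even_second A O x y : even_sub A O -> (x, y) \in O ->
  exists2 y', y' != y & (x, y') \in O.
Proof.
case/even_subP => _ _ eO xy.
case: (set_0Vmem (dnbr O x :\ y)) => [E|[y']]; last first.
  by rewrite !inE => /andP[? ?]; exists y'.
have := eO x; rewrite (cardsD1 y) E cards0 inE xy.
by [].
Qed.

(** * Discharging *)

Section Discharge.
Variables A R : {set V * V}.
Hypotheses (A_sym : dsym A) (A_irr : forall v, (v, v) \notin A).
Hypotheses (RA : R \subset A) (R_sym : dsym R) (spA : sparse A R).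

Let N v := dnbr A v.
Let Q v := ~~ relax A R v.
Let nQ v := #|[set u in N v | Q u]|.
Let NI := [set v | N v != set0].

(** This is what irreducibility provides: no relaxed vertex can be deleted and coloured last, and a
    vertex that is not relaxed has positive even degree, which cannot be 2 because of
    suppression. *)
Hypothesis relaxed_deg : forall v, N v != set0 -> relax A R v -> 5 <= #|N v| + nQ v.
Hypothesis nonrelaxed_deg : forall v, Q v -> 4 <= #|N v|.

Let F := pentas A R.

Lemma penta_card O : O \in F ->
  [\/ #|O| = 6 /\ #|O :&: R| = 4, #|O| = 8 /\ #|O :&: R| = 2 |
      #|O| = 10 /\ #|O :&: R| = 0].
Proof.
rewrite inE => /andP[eO /eqP]; rewrite /wt => w.
have := even_card eO; have := subset_leq_card (subsetIl O R).
case: #|O| w => [|[|[|[|[|[|[|[|[|[|[|n]]]]]]]]]]] //= w le _; try lia.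
- by constructor 1; split => //; lia.
- by constructor 2; split => //; lia.
- by constructor 3; split => //; lia.
Qed.

Lemma penta_even O : O \in F -> even_sub A O.
Proof. by rewrite inE => /andP[]. Qed.

Lemma penta_uniq p O1 O2 : O1 \in F -> O2 \in F -> p \in O1 -> p \in O2 -> O1 = O2.
Proof.
move=> F1 F2 p1 p2; apply/eqP; apply: contraT => ne.
move: F1 F2; rewrite !inE => /andP[e1 /eqP w1] /andP[e2 /eqP w2].
by have /disjointFr/(_ p1) := spA.2 _ _ e1 e2 w1 w2 ne; rewrite p2.
Qed.

(** Here [k] counts darts: 6, 8 and 10 stand for pentagons with three, four and five edges.
    Pentagons are disjoint, so at most one of the three cases applies to a dart. *)
Definition in_penta k p := [exists O in F, (p \in O) && (#|O| == k)].

Lemma in_pentaE k p O : O \in F -> p \in O -> in_penta k p = (#|O| == k).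
Proof.
move=> OF pO; apply/existsP/eqP => [[O' /and3P[F' pO' /eqP <-]]|<-].
  by rewrite (penta_uniq OF F' pO pO').
by exists O; rewrite OF pO /=.
Qed.

Lemma in_pentaP k p : reflect (exists O, [/\ O \in F, p \in O & #|O| = k]) (in_penta k p).
Proof.
apply: (iffP existsP) => [[O /and3P[? ? /eqP ?]]|[O [? ? ?]]]; exists O => //.
by apply/and3P; split => //; apply/eqP.
Qed.

(* Twenty times the charge that [v] pays for the edge [vu]. Over the three kinds
   of pentagons (three edges, two of them in R; four edges, one in R; five
   edges, none in R) these costs add up to 2 for the pentagon plus 2 for each
   of its edges in R. *)
Definition cost (v u : V) :=
  if in_penta 6 (v, u) then 20
  else if in_penta 8 (v, u) then 10
  else if in_penta 10 (v, u) then
    if Q v then if Q u then 4 else 8 else if Q u then 0 else 4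
  else if (v, u) \in R then 20 else 0.

(** The sum splits over the pentagons and the remaining darts. A pentagon contributes
    [6 * 20 = 40 + 20 * 4], [8 * 10 = 40 + 20 * 2] or [10 * 4 = 40], according to its kind; outside
    the pentagons only darts of [R] cost anything, 20 each. *)
Lemma sum_cost : \sum_(p in A) cost p.1 p.2 = 20 * #|R| + 40 * #|F|.
Proof.
have triv : trivIset F.
  apply/trivIsetP => O1 O2; rewrite !inE => /andP[e1 /eqP w1] /andP[e2 /eqP w2].
  exact: spA.2.
have covA : cover F \subset A.
  by apply/bigcupsP => O /penta_even/even_subP[].
have -> : 20 * #|R| = \sum_(p in A) 20 * (p \in R).
  rewrite -big_distrr /= -(setIidPr RA) -sum1_card big_mkcond [in RHS]big_mkcond.
  congr (_ * _); apply: eq_bigr => p _; rewrite inE.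
  by case: (p \in A); case: (p \in R).
rewrite (big_setID (cover F)) [in RHS](big_setID (cover F)) /= (setIidPr covA).
rewrite !big_trivIset //= addnAC; congr (_ + _); last first.
  apply: eq_bigr => -[v u] /setDP[_ nc].
  have ni k : in_penta k (v, u) = false.
    apply: contraNF nc => /in_pentaP[O [OF pO _]].
    by apply/bigcupP; exists O.
  by rewrite /cost !ni /=; case: (_ \in R).
rewrite -sum1_card big_distrr /= -big_split /=; apply: eq_bigr => O OF.
have -> : \sum_(p in O) 20 * (p \in R) = 20 * #|O :&: R|.
  rewrite -big_distrr /= -sum1_card big_mkcond [in RHS]big_mkcond.
  congr (_ * _); apply: eq_bigr => p _; rewrite inE.
  by case: (p \in O); case: (p \in R).
have cE p k : p \in O -> in_penta k (p.1, p.2) = (#|O| == k).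
  by move=> pO; apply: in_pentaE => //; rewrite -surjective_pairing.
case: (penta_card OF) => -[cO cR].
- rewrite (eq_bigr (fun=> 20)) ?sum_nat_const ?cO ?cR // => p pO.
  by rewrite /cost cE // cO.
- rewrite (eq_bigr (fun=> 10)) ?sum_nat_const ?cO ?cR // => p pO.
  by rewrite /cost !cE // cO.
(* The cost of a single dart depends on its ends, but the two orientations of an edge always cost 4
   + 4 or 8 + 0. *)
- pose c (p : V * V) := if Q p.1 then if Q p.2 then 4 else 8
                        else if Q p.2 then 0 else 4.
  rewrite (eq_bigr c) => [|p pO]; last by rewrite /cost !cE // cO.
  have sO : dsym O by case/even_subP: (penta_even OF).
  have E : \sum_(p in O) c p = \sum_(p in O) c (p.2, p.1).
    rewrite (reindex_inj (h := fun p : V * V => (p.2, p.1))) /=; last first.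
      by move=> [a b] [a' b'] [-> ->].
    by apply: eq_bigl => -[a b] /=; rewrite sO.
  have E2 : \sum_(p in O) (c p + c (p.2, p.1)) = 80.
    rewrite (eq_bigr (fun=> 8)) ?sum_nat_const ?cO // => p _; rewrite /c /=.
    by case: (Q p.1); case: (Q p.2).
  by move: E2; rewrite big_split -E cR; move: (\sum_(p in O) c p) => X /=; lia.
Qed.

Lemma Q_noR v : Q v -> dnbr R v = set0.
Proof. by rewrite /Q /relax !negb_or negbK => /and3P[_ _ /eqP]. Qed.

Lemma Q_noRd v u : Q v -> ((v, u) \in R) = false.
Proof. by move/Q_noR/setP/(_ u); rewrite !inE. Qed.

Lemma neqE (x y : V) : x != y -> ((x == y) = false) * ((y == x) = false).
Proof. by move=> xy; rewrite [y == x]eq_sym (negbTE xy). Qed.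

Lemma star_uniq (x y y' : V) : y != x -> y' != x -> y' != y ->
  uniq [:: (x, y); (y, x); (x, y'); (y', x)].
Proof.
move=> h1 h2 h3.
by rewrite /= !inE !xpair_eqE ?eqxx !(neqE h1) !(neqE h2) !(neqE h3) ?andbF.
Qed.

(** Such a pentagon has a single edge outside [R], whereas a vertex that is not relaxed would have
    two of them on it. *)
Lemma penta6_R O x y : O \in F -> #|O| = 6 -> (x, y) \in O -> ~~ Q x.
Proof.
move=> OF cO xy; apply/negP => Qx.
have eO := penta_even OF; have [OA sO _] := even_subP _ _ eO.
have [y' yy' xy'] := even_second eO xy.
have xNy z : (x, z) \in O -> z != x.
  by move=> xz; apply: contraTneq (subsetP OA _ xz) => ->.
have := @card_uniq_ge _ (O :\: R) [:: (x, y); (y, x); (x, y'); (y', x)].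
have -> : #|O :\: R| = 2.
  by rewrite cardsD cO; case: (penta_card OF) => -[]; rewrite cO // => _ ->.
move=> h; suff : 4 <= 2 by [].
apply: h.
  exact: star_uniq (xNy _ xy) (xNy _ xy') yy'.
have nR z : (x, z) \in R = false by exact: Q_noRd.
move=> p; rewrite !inE => /or4P[]/eqP ->; rewrite ?nR ?xy ?xy' //;
by rewrite R_sym nR sO ?xy ?xy'.
Qed.

Lemma in_penta6 v u : in_penta 6 (v, u) -> ~~ Q v && ~~ Q u.
Proof.
case/in_pentaP => O [OF vu cO]; rewrite (penta6_R OF cO vu) /=.
have [_ sO _] := even_subP _ _ (penta_even OF).
by rewrite sO in vu; rewrite (penta6_R OF cO vu).
Qed.

Lemma cost_le v u : cost v u <= 20.
Proof. by rewrite /cost; do ![case: ifP => //]. Qed.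

Lemma cost_Qsrc v u : Q v -> cost v u <= 10 ?= iff in_penta 8 (v, u).
Proof.
move=> Qv; rewrite /cost.
have -> : in_penta 6 (v, u) = false.
  by apply: contraTF Qv => /in_penta6/andP[].
rewrite Q_noRd // Qv; apply/leqifP.
by do ![case: ifP => //].
Qed.

Lemma cost_Qtgt v u : ~~ Q v -> Q u -> cost v u = if in_penta 8 (v, u) then 10 else 0.
Proof.
move=> Qv Qu; rewrite /cost.
have -> : in_penta 6 (v, u) = false.
  by apply: contraTF Qu => /in_penta6/andP[].
rewrite R_sym Q_noRd // (negbTE Qv) Qu.
by do ![case: ifP => //].
Qed.

Let C v := \sum_(u in N v) cost v u.

Lemma sum_le_card (S : {set V}) (f : V -> nat) k :
  (forall u, u \in S -> f u <= k) -> \sum_(u in S) f u <= #|S| * k.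
Proof. by move=> h; rewrite -sum_nat_const; apply: leq_sum. Qed.

(** An edge at [v] lies neither in [R] nor in a pentagon with three edges, so it costs at most 10,
    and [15 d + 140 <= 50 d] for [d >= 4]. *)
Lemma charge_Q v : Q v -> C v + 5 * #|N v| + 140 <= 50 * #|N v| + 5 * nQ v.
Proof.
move=> Qv; have d4 := nonrelaxed_deg Qv.
have : C v <= #|N v| * 10.
  by apply: sum_le_card => u _; case: (cost_Qsrc u Qv).
lia.
Qed.

(** Nothing may be lost: each edge has to cost the full 10, which happens only in pentagons with
    four edges, and nothing may be received from neighbours. *)
Lemma charge_Q_tight v : Q v ->
  50 * #|N v| + 5 * nQ v <= C v + 5 * #|N v| + 140 ->
  nQ v = 0 /\ forall u, u \in N v -> in_penta 8 (v, u).
Proof.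
move=> Qv; have d4 := nonrelaxed_deg Qv.
have h u : u \in N v -> cost v u <= 10 by move=> _; case: (cost_Qsrc u Qv).
have := sum_le_card h => hC t; split; first by move: hC; rewrite -/(C v); lia.
move=> u uN; rewrite -(cost_Qsrc u Qv).2 eqn_leq h //= leqNgt; apply/negP => lt.
suff : C v < #|N v| * 10 by lia.
rewrite /C (big_setD1 u) //= (cardsD1 u) uN mulnDl.
rewrite -addSn leq_add ?mul1n // sum_le_card // => w; rewrite inE => /andP[_ wN].
exact: h.
Qed.

Lemma charge_5 v : 5 <= #|N v| -> C v + 140 < 50 * #|N v| + 5 * nQ v.
Proof.
move=> d5; have : C v <= #|N v| * 20 by apply: sum_le_card => u _; exact: cost_le.
lia.
Qed.

Lemma nQ_split v (f : V -> nat) : \sum_(u in N v) f u =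
  \sum_(u in [set u in N v | Q u]) f u + \sum_(u in [set u in N v | ~~ Q u]) f u.
Proof.
rewrite (bigID Q) /=; congr (_ + _); apply: eq_bigl => u; by rewrite !inE.
Qed.

Lemma nP v : #|[set u in N v | ~~ Q u]| + nQ v = #|N v|.
Proof.
by rewrite /nQ -!sum1_card addnC -nQ_split.
Qed.

(** At least 5 is received, so it suffices to pay at most 60. Two neighbours that are not relaxed
    cost at most 10 each, the other two at most 20 each. With a single such neighbour, its edge is
    either free, or it lies in a pentagon with four edges, whose second edge at [v] also costs only
    10. *)
Lemma charge_4 v : relax A R v -> #|N v| = 4 -> C v + 140 < 50 * #|N v| + 5 * nQ v.
Proof.
move=> rv d4.
have v0 : N v != set0 by rewrite -card_gt0 d4.
have := relaxed_deg v0 rv; rewrite d4 => nq.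
suff : C v <= 60 by lia.
have Qv : ~~ Q v by rewrite negbK.
have cQ u : u \in [set u in N v | Q u] -> cost v u <= 10.
  by rewrite inE => /andP[_ /(cost_Qtgt Qv) ->]; case: ifP.
have cP (S : {set V}) : \sum_(u in S) cost v u <= #|S| * 20.
  by apply: sum_le_card => u _; exact: cost_le.
case: (ltnP 1 (nQ v)) => [n2|n1].
  have := sum_le_card cQ; have := cP [set u in N v | ~~ Q u].
  by rewrite -/(nQ v) /C nQ_split; have := nP v; lia.
have /card_gt0P[q] : 0 < nQ v by lia.
rewrite inE => /andP[qN Qq].
rewrite /C (big_setD1 q) //=.
have c3 : #|N v :\ q| = 3 by move: d4; rewrite (cardsD1 q) qN; clear; lia.
rewrite (cost_Qtgt Qv Qq); case: ifP => [/in_pentaP[O [OF vq cO]]|_]; last first.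
  by have := cP (N v :\ q); rewrite c3.
have [u uq vu] := even_second (penta_even OF) vq.
have uN : u \in N v :\ q.
  rewrite !inE uq; have [OA _ _] := even_subP _ _ (penta_even OF).
  exact: (subsetP OA).
rewrite (big_setD1 u) //=.
have c2 : #|(N v :\ q) :\ u| = 2 by move: c3; rewrite (cardsD1 u) uN; clear; lia.
have -> : cost v u = 10.
  by rewrite /cost !(in_pentaE _ OF vu) cO.
by have := cP ((N v :\ q) :\ u); rewrite c2; clear; lia.
Qed.

(** The edge [ab] in [R] and the following edge at each of its ends form a walk [a' a b b']. It uses
    six of the eight darts, which leaves room for one more edge only. *)
Lemma penta8_R O : O \in F -> #|O| = 8 ->
  exists a b a' b', [/\ (a, b) \in R, b != a, a' != b, b' != a &
    {subset [:: (a, b); (b, a); (a, a'); (a', a); (b, b'); (b', b)] <= O}].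
Proof.
move=> OF cO; have eO := penta_even OF; have [OA sO _] := even_subP _ _ eO.
have /card_gt0P[[a b]] : 0 < #|O :&: R|.
  by case: (penta_card OF) => -[]; rewrite cO // => _ ->.
rewrite inE => /andP[ab abR].
have ba : (b, a) \in O by rewrite -sO.
have [a' aa' aa'O] := even_second eO ab.
have [b' bb' bb'O] := even_second eO ba.
exists a, b, a', b'; split => //.
  by apply: contraTneq (subsetP OA _ ab) => ->.
by move=> p; rewrite !inE => /or4P[|||/or3P[]] /eqP -> //; rewrite -sO.
Qed.

Lemma penta8_uniq (a b a' b' : V) : a' != a -> b' != b ->
  b != a -> a' != b -> b' != a ->
  uniq [:: (a, b); (b, a); (a, a'); (a', a); (b, b'); (b', b)].
Proof.
move=> h1 h2 h3 h4 h5.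
by rewrite /= !inE !xpair_eqE ?eqxx !(neqE h1) !(neqE h2) !(neqE h3)
  !(neqE h4) !(neqE h5) ?andbF.
Qed.

(** By evenness a vertex off the walk brings two edges, hence four darts besides the six of the
    walk: ten in a set of eight. *)
Lemma penta8_outside O a b a' b' x y : O \in F -> #|O| = 8 ->
  b != a -> a' != b -> b' != a ->
  {subset [:: (a, b); (b, a); (a, a'); (a', a); (b, b'); (b', b)] <= O} ->
  (x, y) \in O -> x \notin [:: a; b; a'; b'] -> False.
Proof.
move=> OF cO ba a'b b'a sub xy xN.
have eO := penta_even OF; have [OA sO _] := even_subP _ _ eO.
have irr p q : (p, q) \in O -> q != p.
  by move=> pq; apply: contraTneq (subsetP OA _ pq) => ->.
have [y' yy' xy'] := even_second eO xy.
have a'a : a' != a by apply: irr; apply: sub; rewrite !inE eqxx ?orbT.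
have b'b : b' != b by apply: irr; apply: sub; rewrite !inE eqxx ?orbT.
set s := [:: (a, b); (b, a); (a, a'); (a', a); (b, b'); (b', b)] in sub.
have us : uniq s by exact: penta8_uniq.
have := @card_uniq_ge _ O ([:: (x, y); (y, x); (x, y'); (y', x)] ++ s).
rewrite cO => h; suff : 10 <= 8 by [].
apply: h; last first.
  move=> p; rewrite mem_cat => /orP[|/sub //].
  by rewrite !inE => /or4P[]/eqP -> //; rewrite -sO.
rewrite cat_uniq us andbT.
have xs p : p \in s -> (p.1 != x) && (p.2 != x).
  move: xN; rewrite !inE !negb_or ![x == _]eq_sym => /and4P[h1 h2 h3 h4].
  by case/or4P => [|||/or3P[]] /eqP -> /=; rewrite ?h1 ?h2 ?h3 ?h4.
apply/andP; split.
  have := irr _ _ xy; have := irr _ _ xy' => i1 i2.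
  exact: star_uniq.
apply/hasPn => p /xs /andP[p1 p2]; rewrite !inE; apply/negP.
by case/or4P => /eqP E; move: p1 p2; rewrite E /= eqxx.
Qed.

(** Otherwise [v] has two neighbours on the pentagon that are not relaxed. The ends [a], [b] of the
    edge in [R] are relaxed, so these two edges avoid both, while the six darts of the walk all meet
    [a] or [b]: again ten darts out of eight. *)
Lemma penta8_corner O v : O \in F -> #|O| = 8 ->
  dnbr O v != set0 -> exists2 p, (v, p) \in O & ~~ Q p.
Proof.
move=> OF cO /set0Pn[q]; rewrite inE => vq.
have eO := penta_even OF; have [OA sO _] := even_subP _ _ eO.
case: (boolP (Q q)) => [Qq|]; last by exists q.
have [q' qq' vq'] := even_second eO vq.
case: (boolP (Q q')) => [Qq'|]; last by exists q'.
apply/exists_inP; apply: contraT; rewrite negb_exists_in => /forall_inP allQ.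
have {}allQ p : (v, p) \in O -> Q p by move=> /allQ; rewrite negbK.
have [a [b [a' [b' [abR ba a'b b'a sub]]]]] := penta8_R OF cO.
have aQ : ~~ Q a by apply/negP => /(Q_noRd b); rewrite abR.
have bQ : ~~ Q b by apply/negP => /(Q_noRd a); rewrite -R_sym abR.
have abO : (a, b) \in O by apply: sub; rewrite !inE eqxx.
have va : v != a.
  by apply: contraNneq bQ => E; apply: allQ; rewrite E.
have vb : v != b.
  by apply: contraNneq aQ => E; apply: allQ; rewrite E sO.
have irr p q0 : (p, q0) \in O -> q0 != p.
  by move=> pq; apply: contraTneq (subsetP OA _ pq) => ->.
have a'a : a' != a by apply: irr; apply: sub; rewrite !inE eqxx ?orbT.
have b'b : b' != b by apply: irr; apply: sub; rewrite !inE eqxx ?orbT.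
have us := penta8_uniq a'a b'b ba a'b b'a.
set s := [:: (a, b); (b, a); (a, a'); (a', a); (b, b'); (b', b)] in sub us.
have := @card_uniq_ge _ O ([:: (v, q); (q, v); (v, q'); (q', v)] ++ s).
rewrite cO => h; suff : 10 <= 8 by [].
apply: h; last first.
  move=> p; rewrite mem_cat => /orP[|/sub //].
  by rewrite !inE => /or4P[]/eqP -> //; rewrite -sO.
rewrite cat_uniq us andbT.
have ne w : Q w -> (w != a) && (w != b).
  by move=> Qw; apply/andP; split; apply: contraTneq Qw => ->.
have /andP[qa qb] := ne _ Qq; have /andP[q'a q'b] := ne _ Qq'.
have xs p : p \in s -> (p.1 \in [:: a; b]) || (p.2 \in [:: a; b]).
  by rewrite !inE => /or4P[|||/or3P[]] /eqP -> /=; rewrite eqxx ?orbT.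
apply/andP; split.
  have := irr _ _ vq; have := irr _ _ vq' => i1 i2.
  exact: star_uniq.
apply/hasPn => p /xs; rewrite !inE => ps; apply/negP.
case/or4P => /eqP E; move: ps; rewrite E /=;
by rewrite ?(negbTE va) ?(negbTE vb) ?(negbTE qa) ?(negbTE qb) ?(negbTE q'a) ?(negbTE q'b).
Qed.

(** At most one neighbour is relaxed. If [v] is on no pentagon with four edges, only the edge to
    that neighbour can cost anything. If it is on one, the two edges at [v] cost 10 each and one of
    them leads to the relaxed neighbour; the third edge is free, as a second such pentagon would
    need two further edges at [v]. *)
Lemma charge_3 v : relax A R v -> #|N v| = 3 -> 2 <= nQ v /\ C v <= 20.
Proof.
move=> rv d3.
have v0 : N v != set0 by rewrite -card_gt0 d3.
have := relaxed_deg v0 rv; rewrite d3 => nq.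
have nq2 : 2 <= nQ v by lia.
have oneP : #|[set u in N v | ~~ Q u]| <= 1 by have := nP v; lia.
split => //.
have Qv : ~~ Q v by rewrite negbK.
case: (boolP [exists u in N v, in_penta 8 (v, u)]) => [|noD]; last first.
  rewrite /C nQ_split big1 ?add0n.
    apply: leq_trans (_ : 1 * 20 <= 20) => //.
    apply: leq_trans (sum_le_card (k := 20) _) _; first by move=> u _; exact: cost_le.
    by rewrite leq_mul2r orFb.
  move=> u; rewrite inE => /andP[uN Qu]; rewrite cost_Qtgt //.
  by case: ifP => // h; case/existsP: noD; exists u; rewrite uN h.
case/existsP => u /andP[uN /in_pentaP[O [OF vu cO]]].
have eO := penta_even OF; have [OA sO ev] := even_subP _ _ eO.
have O0 : dnbr O v != set0 by apply/set0Pn; exists u; rewrite inE.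
have [p vp Qp] := penta8_corner OF cO O0.
have ON : dnbr O v \subset N v.
  by apply/subsetP => w; rewrite !inE; exact: (subsetP OA).
have cOv : #|dnbr O v| = 2.
  have := subset_leq_card ON; rewrite d3; have := ev v; move: O0; rewrite -card_gt0.
  by case: #|dnbr O v| => [|[|[|[|n]]]].
rewrite /C (big_setID (dnbr O v)) /= (setIidPr ON).
rewrite (eq_bigr (fun=> 10)); last first.
  by move=> w; rewrite inE => vw; rewrite /cost !(in_pentaE _ OF vw) cO.
rewrite sum_nat_const cOv big1 // => w; rewrite inE => /andP[wO wN].
have pN : p \in [set u in N v | ~~ Q u] by rewrite !inE Qp (subsetP OA).
have Qw : Q w.
  apply: contraT => nQw.
  have wN' : w \in [set u in N v | ~~ Q u] by rewrite inE wN.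
  have E := card_le1_eqP oneP _ _ pN wN'.
  by move: wO; rewrite E inE vp.
rewrite cost_Qtgt //; case: ifP => // /in_pentaP[O' [OF' vw cO']].
have [w' ww' vw'] := even_second (penta_even OF') vw.
have [OA' _ _] := even_subP _ _ (penta_even OF').
have cD : #|N v :\: dnbr O v| = 1 by rewrite cardsD (setIidPr ON) d3 cOv.
case: (boolP ((v, w') \in O)) => [vw'O|nvw'].
  by move: wO; rewrite inE (penta_uniq OF OF' vw'O vw') vw.
have wD : w \in N v :\: dnbr O v by rewrite inE wO.
have wD' : w' \in N v :\: dnbr O v by rewrite !inE nvw' (subsetP OA').
have c1 : #|N v :\: dnbr O v| <= 1 by rewrite cD.
by move: ww'; rewrite (card_le1_eqP c1 _ _ wD' wD) eqxx.
Qed.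

(* The summand [5 * #|N v|] is the charge that a vertex which is not relaxed
   gives to its neighbours, 1/4 to each. *)
Let lhs v := C v + (if Q v then 5 * #|N v| else 0) + 140.
Let rhs v := 50 * #|N v| + 5 * nQ v.

Lemma charge_le v : v \in NI -> lhs v <= rhs v.
Proof.
rewrite inE => vN; rewrite /lhs /rhs; case: ifP => [/charge_Q //|/negbFE rv].
rewrite addn0; have d := relaxed_deg vN rv; have := nP v => np.
case: (ltnP 4 #|N v|) => [/charge_5/ltnW //|].
rewrite leq_eqVlt => /orP[/eqP /(charge_4 rv) /ltnW //|d4].
have d3 : #|N v| = 3 by move: np d d4; clear; lia.
by have [] := charge_3 rv d3; rewrite d3; clear; lia.
Qed.

(** If all vertices were tight, those not relaxed would have only relaxed neighbours and lie on
    pentagons with four edges, while a relaxed one would have degree 3 and at most one relaxed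
    neighbour. On such a pentagon the ends [a], [b] of the edge in [R] use up each other's relaxed
    neighbour, so [a'] and [b'] are not relaxed. The fourth edge has a relaxed end, which is then
    off the walk, and this is impossible. *)
Lemma charge_lt : A != set0 -> exists2 v, v \in NI & lhs v < rhs v.
Proof.
move=> A0; apply/exists_inP; apply: contraT; rewrite negb_exists_in => /forall_inP tight.
have {}tight v : v \in NI -> rhs v <= lhs v by move/tight; rewrite -leqNgt.
have P3 v : v \in NI -> ~~ Q v -> #|N v| = 3 /\ 2 <= nQ v.
  move=> vN nQv; have rv : relax A R v by rewrite negbK in nQv.
  have := tight v vN; rewrite /lhs /rhs (negbTE nQv) addn0 => t.
  have v0 : N v != set0 by move: vN; rewrite inE.
  have d := relaxed_deg v0 rv; have := nP v => np.
  case: (ltnP 4 #|N v|) => [/charge_5|]; first by move: t; clear; lia.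
  rewrite leq_eqVlt => /orP[/eqP /(charge_4 rv)|d4]; first by move: t; clear; lia.
  have d3 : #|N v| = 3 by move: np d d4; clear; lia.
  by split => //; move: d d3; clear; lia.
have Qt v : v \in NI -> Q v -> nQ v = 0 /\ forall u, u \in N v -> in_penta 8 (v, u).
  by move=> vN Qv; apply: charge_Q_tight => //; have := tight v vN; rewrite /lhs /rhs Qv.
have inNI u v : (u, v) \in A -> (u \in NI) && (v \in NI).
  move=> uv; rewrite !inE; apply/andP; split; apply/set0Pn; first by exists v; rewrite inE.
  by exists u; rewrite inE A_sym.
have [[u0 v0] uv0] := set0Pn _ A0.
have /andP[uN0 _] := inNI _ _ uv0.
have [q qN Qq] : exists2 q, q \in NI & Q q.
  case: (boolP (Q u0)) => [|nQu]; first by exists u0.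
  have [_ nq] := P3 _ uN0 nQu.
  have /card_gt0P[q] : 0 < nQ u0 by exact: leq_trans nq.
  rewrite inE => /andP[qN Qq]; exists q => //.
  by move: qN; rewrite inE => /inNI /andP[].
have [_ qD] := Qt q qN Qq.
have /set0Pn[w wN] : N q != set0 by move: qN; rewrite inE.
have /in_pentaP[O [OF _ cO]] := qD w wN.
have eO := penta_even OF; have [OA sO ev] := even_subP _ _ eO.
have [a [b [a' [b' [abR ba a'b b'a sub]]]]] := penta8_R OF cO.
have aQ : ~~ Q a by apply/negP => /(Q_noRd b); rewrite abR.
have bQ : ~~ Q b by apply/negP => /(Q_noRd a); rewrite -R_sym abR.
have inO p : p \in [:: (a, b); (b, a); (a, a'); (a', a); (b, b'); (b', b)] -> p \in O.
  exact: sub.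
have nbO x y z : (x, y) \in O -> ~~ Q x -> ~~ Q y -> (x, z) \in O -> z != y ->
    Q z /\ dnbr O x = [set y; z].
  move=> xy nQx nQy xz zy.
  have /andP[xN _] := inNI _ _ (subsetP OA _ xy).
  have [d3 nq] := P3 _ xN nQx.
  have oneP : #|[set u in N x | ~~ Q u]| <= 1 by move: (nP x) nq d3; clear; lia.
  have ON : dnbr O x \subset N x.
    by apply/subsetP => t; rewrite !inE; exact: (subsetP OA).
  have yN : y \in [set u in N x | ~~ Q u] by rewrite !inE nQy (subsetP OA).
  split.
    apply: contraT => nQz.
    have zN : z \in [set u in N x | ~~ Q u] by rewrite !inE nQz (subsetP OA).
    by move: zy; rewrite (card_le1_eqP oneP _ _ zN yN) eqxx.
  apply/eqP; rewrite eq_sym eqEcard; apply/andP; split.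
    by apply/subsetP => t; rewrite !inE => /orP[]/eqP ->.
  rewrite cards2 eq_sym zy.
  have := subset_leq_card ON; rewrite d3; have := ev x.
  by case: #|dnbr O x| => [|[|[|[|n]]]].
have abO : (a, b) \in O by apply: inO; rewrite !inE eqxx.
have baO : (b, a) \in O by apply: inO; rewrite !inE eqxx orbT.
have aa'O : (a, a') \in O by apply: inO; rewrite !inE eqxx ?orbT.
have bb'O : (b, b') \in O by apply: inO; rewrite !inE eqxx ?orbT.
have [Qa' nba] := nbO _ _ _ abO aQ bQ aa'O a'b.
have [Qb' nbb] := nbO _ _ _ baO bQ aQ bb'O b'a.
set s := [:: (a, b); (b, a); (a, a'); (a', a); (b, b'); (b', b)] in sub inO.
have [[x y] xyO xyN] : exists2 p, p \in O & p \notin s.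
  apply/exists_inP; apply: contraT; rewrite negb_exists_in => /forall_inP all_s.
  have : O \subset s by apply/subsetP => p /all_s; rewrite negbK.
  by move/subset_leq_card; rewrite cO => h; have := leq_trans h (card_size s).
have nQQ : ~~ (Q x && Q y).
  apply/negP => /andP[Qx Qy].
  have xyA := subsetP OA _ xyO.
  have /andP[xN _] := inNI _ _ xyA.
  have [nq0 _] := Qt x xN Qx.
  have : 0 < nQ x by apply/card_gt0P; exists y; rewrite !inE xyA.
  by rewrite nq0.
have out t z : (t, z) \in O -> (t, z) \notin s -> (z, t) \notin s -> ~~ Q t -> False.
  move=> tz tzN ztN nQt.
  apply: (penta8_outside OF cO ba a'b b'a sub tz).
  rewrite !inE !negb_or; apply/and4P; split; apply/eqP => E.
  - have : z \in dnbr O a by rewrite inE -E.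
    rewrite nba !inE => /orP[]/eqP zE; move: tzN; rewrite E zE !inE eqxx ?orbT //.
  - have : z \in dnbr O b by rewrite inE -E.
    rewrite nbb !inE => /orP[]/eqP zE; move: tzN; rewrite E zE !inE eqxx ?orbT //.
  - by rewrite E Qa' in nQt.
  - by rewrite E Qb' in nQt.
have sC t z : (t, z) \in s -> (z, t) \in s.
  by rewrite !inE => /or4P[|||/or3P[]]/eqP[-> ->]; rewrite eqxx ?orbT.
have yxN : (y, x) \notin s by apply: contra xyN; exact: sC.
case/nandP: nQQ => nQz; first by case: (out _ _ xyO xyN yxN nQz).
by rewrite sO in xyO; case: (out _ _ xyO yxN xyN nQz).
Qed.

Lemma discharge : A != set0 -> 14 * #|NI| + 2 * #|R| + 4 * #|F| < 5 * #|A|.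
Proof.
move=> A0.
have [v vN lt] := charge_lt A0.
have sumlt : \sum_(v in NI) lhs v < \sum_(v in NI) rhs v.
  rewrite (bigD1 v) //= [ltnRHS](bigD1 v) //= -addSn; apply: leq_add => //.
  by apply: leq_sum => u /andP[uN _]; exact: charge_le.
have all0 (f : V -> nat) : (forall v, N v = set0 -> f v = 0) ->
    \sum_(v in NI) f v = \sum_v f v.
  move=> f0; rewrite [RHS](bigID (mem NI)) /= [X in _ + X]big1 ?addn0 //.
  by move=> u; rewrite inE negbK => /eqP /f0.
have sC : \sum_(v in NI) C v = 20 * #|R| + 40 * #|F|.
  rewrite all0 => [|u N0]; last by rewrite /C N0 big_set0.
  by rewrite -sum_cost sum_darts.
have sN : \sum_(v in NI) #|N v| = #|A|.
  by rewrite all0 => [|u ->]; rewrite ?cards0 // -card_darts.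
(* What is sent equals what is received: reversing darts exchanges sources and targets that are not
   relaxed. *)
have sQ : \sum_(v in NI) (if Q v then 5 * #|N v| else 0) = \sum_(v in NI) 5 * nQ v.
  rewrite !all0; first last.
  - by move=> u ->; case: ifP; rewrite ?cards0.
  - by move=> u N0; rewrite /nQ N0; apply/eqP; rewrite muln_eq0 /= cards_eq0;
      apply/eqP/setP => w; rewrite !inE.
  rewrite -[RHS]big_distrr /=.
  rewrite (eq_bigr (fun v => 5 * (\sum_(u in N v) Q v))) => [|u _]; last first.
    by case: (Q u); rewrite sum_nat_const ?muln1 ?muln0.
  rewrite -big_distrr /=; congr (_ * _).
  rewrite -(sum_darts A (fun v u => Q v : nat)).
  rewrite (reindex_inj (h := fun p : V * V => (p.2, p.1))) /=; last first.
    by move=> [x y] [x' y'] [-> ->].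
  rewrite (eq_bigl (mem A)) => [|[x y]]; last by rewrite /= A_sym.
  rewrite (sum_darts A (fun v u => Q u : nat)); apply: eq_bigr => u _.
  rewrite /nQ -sum1_card big_mkcond [RHS]big_mkcond; apply: eq_bigr => w _.
  by rewrite !inE; case: (_ \in A); case: (Q w).
have s50 : \sum_(v in NI) 50 * #|N v| = 50 * #|A| by rewrite -big_distrr /= sN.
have sl : \sum_(v in NI) lhs v =
    20 * #|R| + 40 * #|F| + \sum_(v in NI) 5 * nQ v + #|NI| * 140.
  by rewrite /lhs big_split /= sum_nat_const big_split /= sC sQ.
have sr : \sum_(v in NI) rhs v = 50 * #|A| + \sum_(v in NI) 5 * nQ v.
  by rewrite /rhs big_split /= s50.
move: sumlt; rewrite sl sr.
by move: (\sum_(v in NI) 5 * nQ v) => X; clear; lia.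
Qed.

End Discharge.
End Darts.

(** * Even subgraphs from minors of closed surface complexes *)

Lemma F2_addxx (x : 'F_2) : (x + x = 0)%R.
Proof. by apply/eqP; case: x => [[|[|//]] ?]. Qed.

Lemma F2_add_eq0 (x y : 'F_2) : (x + y = 0)%R -> x = y.
Proof. by move=> /eqP; rewrite addr_eq0 => /eqP ->; case: y => [[|[|//]] ?]; apply: val_inj. Qed.

Section Complex.
Local Open Scope ring_scope.
Variables cell side corner : finType.
Variables (src tgt : side -> cell) (lft rgt : side -> corner).

Definition inc e x : 'F_2 := (src e == x)%:R + (tgt e == x)%:R.
Definition coinc e f : 'F_2 := (lft e == f)%:R + (rgt e == f)%:R.

(** Cells, sides and corners are the vertices, edges and faces of a graph on a closed surface: Euler
    characteristic at least 0, boundary of a boundary equal to 0 mod 2, and connectedness of the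
    graph and of its dual. *)
Definition closed_complex :=
  [/\ (#|side| <= #|cell| + #|corner|)%N,
      forall x f, \sum_e inc e x * coinc e f = 0,
      forall g : cell -> bool, (forall e, g (src e) = g (tgt e)) ->
        forall x y, g x = g y &
      forall g : corner -> bool, (forall e, g (lft e) = g (rgt e)) ->
        forall x y, g x = g y].

Definition touch (B C : {set cell}) e :=
  (src e \in B) && (tgt e \in C) || (src e \in C) && (tgt e \in B).

(** Connectedness through locally constant functions avoids handling paths and matches the
    connectedness of a segment. The empty set qualifies, so isolated vertices may have empty branch
    sets. *)
Definition conn (B : {set cell}) := forall g : cell -> bool,
  (forall e, src e \in B -> tgt e \in B -> g (src e) = g (tgt e)) ->
  {in B &, forall x y, g x = g y}.

Definition minor_model (V : finType) (A : {set V * V}) :=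
  exists B : V -> {set cell},
  [/\ forall u v, u != v -> [disjoint B u & B v],
      forall v, conn (B v) &
      forall u v, (u, v) \in A -> exists e, touch (B u) (B v) e].

Lemma touchC B C e : touch B C e = touch C B e.
Proof. by rewrite /touch orbC. Qed.

(* For a subgraph [H] of the 1-skeleton, the regions are the classes of corners
   (the faces of the complex) under crossing sides outside [H]. *)
Section Regions.
Variable H : {set side}.

Definition cross : rel corner := fun f g =>
  [exists e, (e \notin H) && ((lft e == f) && (rgt e == g) ||
                              (lft e == g) && (rgt e == f))].

Lemma cross_sym : connect_sym cross.
Proof.
by apply: sym_connect_sym => f g; apply: eq_existsb => e; rewrite orbC.
Qed.

Definition region : finType := {f : corner | f \in roots cross}.

Definition in_region (i : region) f := fingraph.root cross f == val i.

Lemma cross_root e : e \notin H ->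
  fingraph.root cross (lft e) = fingraph.root cross (rgt e).
Proof.
move=> eH; apply/fingraph.rootP; first exact: cross_sym.
by apply: connect1; apply/existsP; exists e; rewrite eH !eqxx.
Qed.

Lemma in_region_val (i j : region) : in_region i (val j) = (i == j).
Proof.
rewrite /in_region.
have /eqP -> : fingraph.root cross (val j) == val j by exact: (valP j).
by rewrite eq_sym -val_eqE.
Qed.

Variable Y : {set cell}.
Hypothesis cplx : closed_complex.
Hypothesis Y0 : Y != set0.
Hypothesis HY : forall e, e \in H -> (src e \in Y) && (tgt e \in Y).

Let M : 'M['F_2]_(#|corner|, #|~: H|) :=
  \matrix_(i, j) coinc (enum_val j) (enum_val i).
Let D : 'M['F_2]_(#|~: Y|, #|~: H|) :=
  \matrix_(i, j) inc (enum_val j) (enum_val i).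
Let P : 'M['F_2]_(#|region|, #|corner|) :=
  \matrix_(i, j) (in_region (enum_val i) (enum_val j))%:R.

(** A cell outside [Y] is incident with no side of [H], so the relation between boundaries and
    coboundaries survives dropping the columns in [H]. *)
Let DM : D *m M^T = 0.
Proof.
apply/matrixP => i j; rewrite !mxE.
have [_ bd _ _] := cplx.
rewrite -[RHS](bd (enum_val i) (enum_val j)).
rewrite (bigID [in ~: H]) /= [X in _ = _ + X]big1 ?addr0; last first.
  move=> e; rewrite inE negbK => /HY /andP[sY tY].
  have : enum_val i \in ~: Y by exact: enum_valP.
  rewrite inE /inc => iY.
  have -> : (src e == enum_val i) = false by apply: contraNF iY => /eqP <-.
  have -> : (tgt e == enum_val i) = false by apply: contraNF iY => /eqP <-.
  by rewrite addr0 mul0r.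
rewrite (big_enum_val (fun e => inc e (enum_val i) * coinc e (enum_val j))).
by apply: eq_bigr => k _; rewrite !mxE.
Qed.

(** The coefficients of a relation, extended by 0 to [Y], agree across every side outside [H]; both
    ends of a side in [H] carry 0. Since the cells are connected and [Y] is not empty, all
    coefficients vanish. *)
Let D_free : row_free D.
Proof.
apply: inj_row_free => v vD.
have [_ _ cc _] := cplx.
pose g x : 'F_2 := \sum_i v 0 i * (enum_val i == x)%:R.
have gE e : e \notin H -> g (src e) = g (tgt e).
  move=> eH; apply: F2_add_eq0.
  have eH' : e \in ~: H by rewrite inE.
  move/matrixP/(_ 0 (enum_rank_in eH' e)): vD; rewrite !mxE => vD.
  rewrite -[RHS]vD /g -big_split /=; apply: eq_bigr => i _.
  by rewrite !mxE enum_rankK_in // /inc -mulrDr ![enum_val i == _]eq_sym.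
have gY x : x \in Y -> g x = 0.
  move=> xY; rewrite /g big1 // => i _.
  case: eqP => [iE|]; last by rewrite mulr0.
  by move: (enum_valP i); rewrite inE iE xY.
have gc x y : (g x == 0) = (g y == 0).
  apply: (cc (fun x => g x == 0)) => e.
  case: (boolP (e \in H)) => [/HY /andP[sY tY]|/gE ->//].
  by rewrite !gY.
have /set0Pn[y yY] := Y0.
apply/rowP => i; rewrite mxE.
have : g (enum_val i) = 0 by apply/eqP; rewrite (gc _ y) gY.
rewrite /g (bigD1 i) //= eqxx mulr1 big1 ?addr0 // => k ki.
by rewrite (inj_eq enum_val_inj) (negbTE ki) mulr0.
Qed.

(** A vector in the kernel is a function on corners that agrees across all sides outside [H], hence
    a combination of indicators of regions. *)
Let ker_region : (kermx M <= P)%MS.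
Proof.
apply/row_subP => k; set u := row k _.
have uM : u *m M = 0 by apply/sub_kermxP; exact: row_sub.
pose h f := u 0 (enum_rank f).
have hE e : e \notin H -> h (lft e) = h (rgt e).
  move=> eH; apply: F2_add_eq0.
  have eH' : e \in ~: H by rewrite inE.
  move/matrixP/(_ 0 (enum_rank_in eH' e)): uM.
  rewrite [X in X = _]mxE [X in _ = X]mxE => <-.
  rewrite (reindex (@enum_rank corner)) /=; last exact/onW_bij/enum_rank_bij.
  rewrite [RHS](eq_bigr (fun f => h f * (lft e == f)%:R + h f * (rgt e == f)%:R)).
    rewrite big_split /=; congr (_ + _).
      rewrite (bigD1 (lft e)) //= eqxx mulr1 big1 ?addr0 // => f.
      by rewrite eq_sym => /negbTE ->; rewrite mulr0.
    rewrite (bigD1 (rgt e)) //= eqxx mulr1 big1 ?addr0 // => f.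
    by rewrite eq_sym => /negbTE ->; rewrite mulr0.
  by move=> f _; rewrite /h !mxE enum_rankK enum_rankK_in // /coinc mulrDr.
have hroot f : h f = h (fingraph.root cross f).
  have /connectP[p] := connect_root cross f.
  move: (fingraph.root _ _) => g.
  elim: p f => [|f' p IH] f /=; first by move=> _ ->.
  case/andP => /existsP[e /andP[eH /orP[]/andP[/eqP <- /eqP <-]]] pth lst.
    by rewrite hE //; exact: IH.
  by rewrite -hE //; exact: IH.
apply/submxP; exists (\row_i h (val (enum_val i))).
apply/rowP => j; rewrite [RHS]mxE.
have rr : fingraph.root cross (enum_val j) \in roots cross.
  by rewrite unfold_in root_root //; exact: cross_sym.
pose r0 : region := exist (fun f => f \in roots cross) _ rr.
rewrite (bigD1 (enum_rank r0)) //= big1 ?addr0.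
  rewrite [X in _ = X * _]mxE [X in _ = _ * X]mxE enum_rankK /in_region eqxx.
  by rewrite mulr1 /= -hroot /h enum_valK.
move=> i ir; rewrite !mxE /in_region.
case: eqP => [E|]; last by rewrite mulr0.
case/eqP: ir; apply: enum_val_inj; rewrite enum_rankK.
by apply: val_inj; rewrite -E.
Qed.

(* The coboundaries of the cells outside [Y] are independent and orthogonal to
   the boundaries of the corners, which bounds the rank of the latter. *)
Lemma region_count : (#|H| <= #|Y| + #|region|)%N.
Proof.
have [eu _ _ _] := cplx.
(* Orthogonality gives [(|cell| - |Y|) + (|corner| - |region|) <= |side| - |H|]. *)
have := mulmx0_rank_max DM; rewrite mxrank_tr (eqP D_free).
have := mxrankS ker_region; rewrite mxrank_ker.
have := rank_leq_row P; have := rank_leq_row M.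
have := cardsC Y; have := cardsC H; have := subset_leq_card (subsetT H).
lia.
Qed.

End Regions.

Definition joins e x y :=
  (src e == x) && (tgt e == y) || (src e == y) && (tgt e == x).

Lemma tree_exists (B : {set cell}) r (e0 : side) : conn B -> r \in B ->
  exists (t : cell -> side) (d : cell -> nat),
    forall x, x \in B -> x != r ->
    exists2 y, y \in B & joins (t x) x y && (d y < d x)%N.
Proof.
move=> cB rB.
pose relB x y := [&& x \in B, y \in B & [exists e, joins e x y]].
pose step (S : {set cell}) :=
  S :|: [set x in B | [exists e, [exists y in S, joins e x y]]].
pose L n := iter n step [set r].
have LB n : L n \subset B.
  elim: n => [|n IH]; first by rewrite sub1set.
  by rewrite /L iterS -/(L n) subUset IH; apply/subsetP => x; rewrite inE => /andP[].
have reach x : x \in B -> connect relB r x.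
  move=> xB; rewrite -(cB (connect relB r) _ r x rB xB) ?connect0 //.
  move=> e sB tB.
  have jst : relB (src e) (tgt e) && relB (tgt e) (src e).
    rewrite /relB sB tB /=; apply/andP; split; apply/existsP; exists e;
    by rewrite /joins !eqxx ?orbT.
  case/andP: jst => jst jts.
  apply/idP/idP => h; apply: connect_trans h _; exact: connect1.
have inL x : x \in B -> exists n, x \in L n.
  move=> /reach/connectP[p]; elim/last_ind: p x => [|p y IH] x /=.
    by move=> _ ->; exists 0%N; rewrite inE.
  rewrite rcons_path last_rcons => /andP[pth lst] ->.
  have [n nL] := IH _ pth erefl; exists n.+1.
  case/and3P: lst => _ yB /existsP[e j].
  rewrite /L iterS -/(L n) !inE yB /=; apply/orP; right.
  apply/existsP; exists e; apply/existsP; exists (last r p).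
  by rewrite nL /= /joins orbC.
have [d dP] : exists d : cell -> nat, forall x, x \in B ->
    x \in L (d x) /\ forall m, x \in L m -> (d x <= m)%N.
  apply: (fin_all_exists (P := fun x n => x \in B ->
    x \in L n /\ forall m, x \in L m -> (n <= m)%N)) => x.
  case: (boolP (x \in B)) => [/inL xL|]; last by exists 0%N.
  by case: (ex_minnP xL) => n nL nm; exists n.
have [t tP] : exists t : cell -> side, forall x, x \in B -> x != r ->
    exists2 y, y \in B & joins (t x) x y && (d y < d x)%N.
  apply: (fin_all_exists (P := fun x e => x \in B -> x != r ->
    exists2 y, y \in B & joins e x y && (d y < d x)%N)) => x.
  case: (boolP (x \in B)) => xB; last by exists e0.
  case: (eqVneq x r) => xr; first by exists e0; rewrite xr.
  have [xL xmin] := dP x xB.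
  case E : (d x) => [|n]; first by move: xL xr; rewrite E inE => /eqP ->; rewrite eqxx.
  move: xL; rewrite E /L iterS -/(L n) !inE xB /=.
  case/orP => [/xmin|]; first by rewrite E ltnn.
  case/existsP => e /existsP[y /andP[yL j]]; exists e => _ _; exists y.
    exact: (subsetP (LB n)).
  by rewrite j /=; have [_ /(_ _ yL)] := dP y (subsetP (LB n) _ yL).
by exists t, d.
Qed.

Definition bd (S : corner -> 'F_2) e : 'F_2 := S (lft e) + S (rgt e).

Lemma F2_nz (x : 'F_2) : (x != 0)%:R = x.
Proof. by case: x => [[|[|//]] ?]; apply: val_inj. Qed.

Lemma F2_nat n : (n%:R == 0 :> 'F_2) = ~~ odd n.
Proof.
rewrite -{1}(odd_double_half n) natrD -addnn natrD F2_addxx addr0.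
by case: (odd n); rewrite ?oner_eq0 ?eqxx.
Qed.

Lemma sumr_delta (T : finType) (h : T -> 'F_2) y :
  \sum_x (h x * (y == x)%:R) = h y.
Proof.
rewrite (bigD1 y) //= eqxx mulr1 big1 ?addr0 // => x.
by rewrite eq_sym => /negbTE ->; rewrite mulr0.
Qed.

Lemma bd_cycle S x : closed_complex -> \sum_e inc e x * bd S e = 0.
Proof.
case=> _ cyc _ _.
rewrite (eq_bigr (fun e => \sum_f S f * (inc e x * coinc e f))) => [|e _].
  rewrite exchange_big /= big1 // => f _.
  by rewrite -mulr_sumr cyc mulr0.
rewrite /bd /coinc -!(sumr_delta S) -big_split /= mulr_sumr.
apply: eq_bigr => f _; rewrite mulrCA; congr (_ * _).
by rewrite mulrDr.
Qed.

Lemma sum_inc_set (B : {set cell}) e :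
  \sum_(x in B) inc e x = (src e \in B)%:R + (tgt e \in B)%:R.
Proof.
have aux y : \sum_(x in B) (y == x)%:R = (y \in B)%:R :> 'F_2.
  rewrite big_mkcond -(sumr_delta (fun x => (x \in B)%:R)).
  by apply: eq_bigr => x _; case: (x \in B); rewrite ?mul1r ?mul0r.
by rewrite big_split /= !aux.
Qed.

Section Minor.
Variables (V : finType) (A : {set V * V}) (B : V -> {set cell}).
Hypothesis cplx : closed_complex.
Hypothesis A_sym : dsym A.
Hypothesis A_irr : forall v, (v, v) \notin A.
Hypothesis A0 : A != set0.
Hypothesis B_disj : forall u v, u != v -> [disjoint B u & B v].
Hypothesis B_conn : forall v, conn (B v).
Hypothesis B_touch : forall u v, (u, v) \in A -> exists e, touch (B u) (B v) e.

Let NI := [set v | dnbr A v != set0].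

Let B_own u v x : x \in B u -> x \in B v -> u = v.
Proof.
move=> xu xv; apply/eqP; apply: contraT => /B_disj.
by move/disjointFr => /(_ _ xu); rewrite xv.
Qed.

(** Let [H] consist of spanning trees of the branch sets and one side per edge. It has
    [|U| - |NI| + |E|] sides on the [|U|] cells of the branch sets, so at least [|E| - |NI|]
    regions. [Z i] collects the edges whose side has exactly one corner in region [i]. A region with
    empty [Z i], or two with equal ones, would give a boundary contained in the trees; being a cycle
    it vanishes, so the chain is constant on all corners, which a third region excludes. *)
Lemma minor_even_family : exists (I : finType) (Z : I -> {set V * V}),
  [/\ forall i, even_sub A (Z i),
      (#|A| <= 2 * (#|NI| + #|I|))%N,
      forall p, (#|[set i | p \in Z i]| <= 2)%N &
      (2 < #|I|)%N -> injective Z /\ forall i, Z i != set0].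
Proof.
have [[u0 v0] uvA] := set0Pn _ A0.
have [e0 _] := B_touch uvA.
(* As [touch] is symmetric in the branch sets, [pick] selects the same side for both darts of an
   edge. *)
pose es u v := odflt e0 [pick e | touch (B u) (B v) e].
have esC u v : es u v = es v u.
  by congr odflt; apply: eq_pick => e; rewrite /= touchC.
have esP u v : (u, v) \in A -> touch (B u) (B v) (es u v).
  move=> /B_touch[e te]; rewrite /es; case: pickP => [//|/(_ e)].
  by rewrite te.
have NIB v : v \in NI -> exists x, x \in B v.
  rewrite inE => /set0Pn[u]; rewrite inE => /B_touch[e].
  by case/orP => /andP[a b]; [exists (src e)|exists (tgt e)].
have ANI u v : (u, v) \in A -> (u \in NI) && (v \in NI).
  move=> uv; rewrite !inE; apply/andP; split; apply/set0Pn; first by exists v; rewrite inE.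
  by exists u; rewrite inE A_sym.
have NIB' v : exists x, v \in NI -> x \in B v.
  case: (boolP (v \in NI)) => [/NIB[x]|_]; first by exists x.
  by exists (src e0).
have [rt rtP] : exists rt : V -> cell, forall v, v \in NI -> rt v \in B v.
  exact: (fin_all_exists (P := fun v x => v \in NI -> x \in B v)).
have [td tdP] : exists td : V -> (cell -> side) * (cell -> nat),
    forall v, v \in NI -> forall x, x \in B v -> x != rt v ->
    exists2 y, y \in B v &
      joins ((td v).1 x) x y && ((td v).2 y < (td v).2 x)%N.
  apply: (fin_all_exists (P := fun v td => v \in NI -> forall x,
    x \in B v -> x != rt v ->
    exists2 y, y \in B v & joins (td.1 x) x y && (td.2 y < td.2 x)%N)) => v.
  case: (boolP (v \in NI)) => [vN|_]; last by exists (fun=> e0, fun=> 0%N).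
  have [t [d tdP]] := tree_exists e0 (@B_conn v) (rtP v vN).
  by exists (t, d).
pose t (p : V * cell) := (td p.1).1 p.2.
pose d (p : V * cell) := (td p.1).2 p.2.
pose PU := [set p : V * cell | (p.1 \in NI) && (p.2 \in B p.1)].
pose NR := PU :\: [set (v, rt v) | v in NI].
have NRP p : p \in NR -> exists2 y, y \in B p.1 &
    [&& p.1 \in NI, p.2 \in B p.1, joins (t p) p.2 y & (d (p.1, y) < d p)%N].
  case: p => v x; rewrite in_setD => /andP[nr]; rewrite in_set /= => /andP[vN xB].
  have xr : x != rt v.
    by apply: contra nr => /eqP ->; apply/imsetP; exists v.
  by have [y yB /andP[j ds]] := tdP v vN x xB xr; exists y => //; rewrite vN xB /t /d j.
pose U := [set p.2 | p in PU].
have cU : #|U| = #|PU|.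
  apply: card_in_imset => -[u x] [v y]; rewrite !inE /= => /andP[_ xu] /andP[_ yv] E.
  by move: E yv xu => -> yv yu; rewrite (B_own yu yv).
have BU v x : v \in NI -> x \in B v -> x \in U.
  by move=> vN xB; apply/imsetP; exists (v, x) => //; rewrite inE /= vN xB.
have cNR : #|PU| = (#|NI| + #|NR|)%N.
  have sub : [set (v, rt v) | v in NI] \subset PU.
    by apply/subsetP => _ /imsetP[v vN ->]; rewrite inE /= vN rtP.
  rewrite /NR cardsD (setIidPr sub) card_in_imset; last by move=> u v _ _ [].
  have := subset_leq_card sub; rewrite card_in_imset; last by move=> u v _ _ [].
  by move=> h; rewrite subnKC.
pose Ht := t @: NR.
(* Two cells sharing their parent side would be parents of each other, and the depth would decrease
   in both directions. *)
have t_inj : {in NR &, injective t}.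
  move=> p q pN qN E.
  have [y yB /and4P[vN xB j ds]] := NRP p pN.
  have [y' yB' /and4P[vN' xB' j' ds']] := NRP q qN.
  rewrite -E in j'.
  have [pq|[E1 E2]] : p.2 = q.2 \/ (p.2 = y' /\ q.2 = y).
    case/orP: j => /andP[/eqP a /eqP b]; case/orP: j' => /andP[/eqP a' /eqP b'].
    - by left; congruence.
    - by right; split; congruence.
    - by right; split; congruence.
    - by left; congruence.
  - have E1 : p.1 = q.1 by apply: (B_own xB); rewrite pq.
    by rewrite (surjective_pairing p) (surjective_pairing q) E1 pq.
  - have E3 : p.1 = q.1 by apply: (B_own xB); rewrite E1.
    have e1 : (p.1, y) = q by rewrite E3 -E2 -surjective_pairing.
    have e2 : (q.1, y') = p by rewrite -E3 -E1 -surjective_pairing.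
    by rewrite e1 in ds; rewrite e2 in ds'; have := ltn_trans ds ds'; rewrite ltnn.
have HtP e : e \in Ht -> exists2 v, v \in NI & (src e \in B v) && (tgt e \in B v).
  case/imsetP => p pN ->; have [y yB /and4P[vN xB j ds]] := NRP p pN.
  exists p.1 => //; case/orP: j => /andP[/eqP -> /eqP ->]; by rewrite xB yB.
pose Es := [set es p.1 p.2 | p in A].
have EsP e : e \in Es -> exists u v, [/\ (u, v) \in A, e = es u v & u != v].
  case/imsetP => -[u v] uA ->; exists u, v; split => //.
  by apply: contraTneq uA => ->.
have esE u v u' v' : (u, v) \in A -> (u', v') \in A -> es u v = es u' v' ->
    (u = u' /\ v = v') \/ (u = v' /\ v = u').
  move=> uv uv' E; have := esP _ _ uv; have := esP _ _ uv'; rewrite -E.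
  case/orP => /andP[a b]; case/orP => /andP[a' b'].
  - by left; rewrite (B_own a a') (B_own b b').
  - by right; rewrite (B_own a a') (B_own b b').
  - by right; rewrite (B_own a a') (B_own b b').
  - by left; rewrite (B_own a a') (B_own b b').
have cEs : (#|A| <= 2 * #|Es|)%N.
  rewrite -sum1_card (partition_big_imset (fun p => es p.1 p.2)) /= -/Es.
  rewrite mulnC -sum_nat_const; apply: leq_sum => e /EsP[u [v [uv eE _]]].
  rewrite sum1_card; apply: leq_trans (_ : #|[set (u, v); (v, u)]| <= 2)%N; last first.
    by rewrite cards2; case: eqP.
  apply: subset_leq_card; apply/subsetP => -[u' v']; rewrite !inE unfold_in /= eE.
  case/andP => uv' /eqP /(esE _ _ _ _ uv' uv).
  by case=> -[-> ->]; rewrite eqxx ?orbT.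
have HtEs : [disjoint Ht & Es].
  apply/pred0P => e /=; apply: negbTE; apply/negP => /andP[/HtP[w _ /andP[sw tw]]].
  case/EsP => u [v [uv eE uv']]; have := esP _ _ uv; rewrite -eE.
  by case/orP => /andP[a b]; move: uv';
    rewrite -(B_own sw a) -(B_own tw b) eqxx.
pose H := Ht :|: Es.
have HU e : e \in H -> (src e \in U) && (tgt e \in U).
  rewrite inE => /orP[/HtP[v vN /andP[a b]]|/EsP[u [v [uv -> _]]]].
    by rewrite (BU _ _ vN a) (BU _ _ vN b).
  have /andP[uN vN] := ANI _ _ uv.
  case/orP: (esP _ _ uv) => /andP[a b].
    by rewrite (BU _ _ uN a) (BU _ _ vN b).
  by rewrite (BU _ _ vN a) (BU _ _ uN b).
have U0 : U != set0.
  have /andP[uN _] := ANI _ _ uvA.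
  by apply/set0Pn; exists (rt u0); apply: (BU u0) => //; exact: rtP.
have cnt := region_count cplx U0 HU.
have cH : #|H| = (#|NR| + #|Es|)%N.
  by rewrite cardsU disjoint_setI0 // cards0 subn0 card_in_imset.
(* A cycle supported in the trees vanishes: take its deepest cell [p] with nonzero parent side. The
   other tree sides at [p] lead to deeper cells, where [z] is zero, so the sum at [p] is
   [z (t p)]. *)
have acyclic z : (forall x, \sum_e inc e x * z e = 0) ->
    (forall e, e \notin H -> z e = 0) -> (forall e, e \in Es -> z e = 0) ->
    forall e, z e = 0.
  move=> zc zH zE.
  have zt : forall p, p \in NR -> z (t p) = 0; last first.
    move=> e; case: (boolP (e \in H)) => [|/zH //].
    by rewrite inE => /orP[/imsetP[p pN ->]|/zE //]; exact: zt.
  move=> p0 p0N; apply/eqP; apply: contraT => zp0.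
  pose Q p := (p \in NR) && (z (t p) != 0).
  have Qp0 : Q p0 by rewrite /Q p0N.
  case: (arg_maxnP d Qp0) => p /andP[pN zp] pmax.
  have [y yB /and4P[vN xB j ds]] := NRP p pN.
  have xy : p.2 != y.
    by apply: contraTneq ds => <-; rewrite -surjective_pairing ltnn.
  have := zc p.2; rewrite (bigD1 (t p)) //= big1 ?addr0.
    have -> : inc (t p) p.2 = 1.
      rewrite /inc; case/orP: j => /andP[/eqP -> /eqP ->]; rewrite eqxx.
        by rewrite eq_sym (negbTE xy) addr0.
      by rewrite eq_sym (negbTE xy) add0r.
    by rewrite mul1r => /eqP; rewrite (negbTE zp).
  move=> e eN; case: (eqVneq (z e) 0) => [->|ze]; first by rewrite mulr0.
  have eH : e \in H by apply: contraTT ze => /zH ->; rewrite eqxx.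
  move: eH; rewrite inE => /orP[/imsetP[q qN eE]|/zE E]; last by rewrite E eqxx in ze.
  have [y' yB' /and4P[vN' xB' j' ds']] := NRP q qN.
  rewrite -eE in j'.
  have [i0|] := eqVneq (inc e p.2) 0; first by rewrite i0 mul0r.
  have : (p.2 == q.2) || (p.2 == y') -> False.
    case/orP => /eqP E.
      case/eqP: eN; rewrite eE; congr t.
      have E1 : p.1 = q.1 by apply: (B_own xB); rewrite E.
      by rewrite (surjective_pairing p) (surjective_pairing q) E1 E.
    have E3 : p.1 = q.1 by apply: (B_own xB); rewrite E.
    have /pmax : Q q by rewrite /Q qN -eE.
    by move: ds'; rewrite -E -E3 -surjective_pairing => a b; have := leq_trans a b; rewrite ltnn.
  rewrite /inc; case/orP: j' => /andP[/eqP -> /eqP ->]; rewrite ![_ == p.2]eq_sym.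
    by do 2![case: eqP => _ //=].
  by do 2![case: eqP => _ //=].
pose reg (i : region H) f : 'F_2 := (in_region i f)%:R.
have regH i e : e \notin H -> bd (reg i) e = 0.
  by move=> /cross_root E; rewrite /bd /reg /in_region E F2_addxx.
pose Z i := [set p in A | bd (reg i) (es p.1 p.2) != 0].
have Sconst (S : corner -> 'F_2) : (forall e, e \notin H -> bd S e = 0) ->
    (forall e, e \in Es -> bd S e = 0) -> forall f g, (S f == 0) = (S g == 0).
  move=> S1 S2; have [_ _ _ cc] := cplx.
  apply: (cc (fun f => S f == 0)) => e.
  have := acyclic (bd S) (fun x => bd_cycle S x cplx) S1 S2 e.
  by move/F2_add_eq0 ->.
have regv i j : reg i (val j) = (i == j)%:R by rewrite /reg in_region_val.
exists (region H), Z; split.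
- move=> i; apply/even_subP; split.
  + by apply/subsetP => p; rewrite inE => /andP[].
  + by move=> x y; rewrite !inE /= A_sym esC.
  + move=> v; rewrite -F2_nat; apply/eqP.
    have -> : (#|dnbr (Z i) v|)%:R = \sum_(u in dnbr A v) bd (reg i) (es v u) :> 'F_2.
      rewrite -sum1_card natr_sum big_mkcond [RHS]big_mkcond /=.
      apply: eq_bigr => u _; rewrite !inE /=.
      case: ((v, u) \in A) => //=.
      by rewrite -[RHS]F2_nz; case: (_ != 0).
    have es_inj : {in dnbr A v &, injective (es v)}.
      move=> u w; rewrite !inE => vu vw /(esE _ _ _ _ vu vw)[[]//|[E1 E2]].
      by rewrite E2 -E1.
    rewrite -(big_imset (bd (reg i))) //=.
    (* Add the cycle condition over the branch set of [v]: tree sides count twice or not at all, and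
       exactly the sides chosen for the edges at [v] remain. *)
    have : \sum_(x in B v) \sum_e inc e x * bd (reg i) e = 0.
      by rewrite big1 // => x _; exact: bd_cycle.
    rewrite exchange_big /= => sum0; rewrite -[RHS]sum0.
    rewrite [LHS]big_mkcond; apply: eq_bigr => e _.
    rewrite -mulr_suml sum_inc_set.
    case: ifP => [/imsetP[u]|eN].
      rewrite inE => vu ->.
      have vNu : v != u by apply: contraTneq vu => <-.
      have nb x : x \in B u -> (x \in B v) = false.
        by move=> xu; apply: contraNF vNu => xv; apply/eqP; exact: B_own xv xu.
      by case/orP: (esP _ _ vu) => /andP[a b]; rewrite ?a ?b ?(nb _ a) ?(nb _ b)
        ?add0r ?addr0 mul1r.
    case: (boolP (e \in H)) => [|/regH ->]; last by rewrite mulr0.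
    rewrite inE => /orP[/HtP[w wN /andP[a b]]|/EsP[u [w [uw eE uNw]]]].
      have E x : x \in B w -> (x \in B v) = (w == v).
        by move=> xw; apply/idP/eqP => [xv|<-//]; exact: B_own xw xv.
      by rewrite !E // F2_addxx mul0r.
    have uv : (u == v) = false.
      apply: contraFF eN => /eqP E; apply/imsetP; exists w; rewrite ?inE -E //.
    have wv : (w == v) = false.
      apply: contraFF eN => /eqP E; apply/imsetP; exists u.
        by rewrite inE -E A_sym.
      by rewrite -E esC.
    have E x y : x \in B y -> (x \in B v) = (y == v).
      by move=> xw; apply/idP/eqP => [xv|<-//]; exact: B_own xw xv.
    have := esP _ _ uw; rewrite -eE => /orP[]/andP[a b];
    by rewrite (E _ _ a) (E _ _ b) uv wv addr0 mul0r.
- by move: cnt; rewrite cH cU cNR; lia.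
- move=> p; set S := [set i | _].
  pose e := es p.1 p.2.
  have -> : #|S| = #|[set val i | i in S]| by rewrite card_imset //; exact: val_inj.
  apply: leq_trans (_ : #|[set fingraph.root (cross H) (lft e);
      fingraph.root (cross H) (rgt e)]| <= 2)%N; last by rewrite cards2; case: eqP.
  apply: subset_leq_card; apply/subsetP => _ /imsetP[i + ->].
  rewrite !inE => /andP[_]; rewrite -/e /bd /reg /in_region ![val i == _]eq_sym.
  by do 2![case: (_ == val i) => //=]; rewrite addr0 eqxx.
- move=> big.
  have third (i j : region H) : exists k, (k != i) && (k != j).
    apply/existsP; apply: contraT; rewrite negb_exists => /forallP nk.
    have : [set: region H] \subset [set i; j].
      apply/subsetP => k _; rewrite !inE; apply: contraT; rewrite negb_or => h.
      by have := nk k; rewrite h.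
    move/subset_leq_card; rewrite cardsT cards2 => h.
    by move: (leq_trans big h); case: eqP.
  split.
    move=> i j E; apply/eqP; apply: contraT => ij.
    have [k /andP[ki kj]] := third i j.
    (* The sum of the two indicators is 1 on region [i] and 0 on the third region [k]. *)
    have := Sconst (fun f => reg i f + reg j f) _ _ (val i) (val k).
    rewrite !regv eqxx [j == i]eq_sym (negbTE ij) [i == k]eq_sym [j == k]eq_sym.
    rewrite (negbTE ki) (negbTE kj) !addr0 oner_eq0 eqxx => -> //.
      by move=> e eH; rewrite /bd addrACA -!/(bd _ _) !regH // addr0.
    move=> e /EsP[u [v [uv -> _]]]; rewrite /bd addrACA -!/(bd _ _).
    suff -> : bd (reg i) (es u v) = bd (reg j) (es u v) by rewrite F2_addxx.
    rewrite -[LHS]F2_nz -[RHS]F2_nz; congr (nat_of_bool _)%:R.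
    by move/setP/(_ (u, v)): E; rewrite !inE uv.
  move=> i; apply/negP => /eqP E.
  have [k /andP[ki _]] := third i i.
  suff : false = true by [].
  have := Sconst (reg i) (regH i) _ (val i) (val k).
  rewrite !regv eqxx oner_eq0 [i == k]eq_sym (negbTE ki) eqxx => -> //.
  move=> e /EsP[u [v [uv -> _]]].
  by move/setP/(_ (u, v)): E; rewrite !inE uv /= => /negbFE/eqP.
Qed.

End Minor.
End Complex.

(** * Reductions *)

Section Induction.
Variable V : finType.
Implicit Types (A O R : {set V * V}) (u v w x y : V).

(** Summing weights gives [14 |I| <= 2 |A| + 2 |R| + 4 |F|], with [F] the set of pentagons; combine
    this with [7 |A| <= 14 n + 14 |I|]. *)
Lemma euler_bound (cell side corner : finType) (src tgt : side -> cell)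
    (lft rgt : side -> corner) A R :
  closed_complex src tgt lft rgt -> dsym A -> (forall v, (v, v) \notin A) ->
  sparse A R -> R \subset A -> minor_model src tgt A ->
  5 <= #|[set v | dnbr A v != set0]| ->
  5 * #|A| <= 14 * #|[set v | dnbr A v != set0]| + 2 * #|R| + 4 * #|pentas A R|.
Proof.
move=> cplx A_sym A_irr spA RA [B [Bd Bc Bt]] n5.
have [->|A0] := eqVneq A set0; first by rewrite cards0.
have [I [Z [Ze cA Z2 ZI]]] := minor_even_family cplx A_sym A_irr A0 Bd Bc Bt.
move: n5 cA; set n := #|_| => n5 cA.
(* With at most two regions the sets [Z i] may be empty or equal, but then
   [5 |A| <= 10 n + 20 <= 14 n] because [n >= 5]. *)
case: (leqP #|I| 2) => [I2|/ZI[Zinj Z0]]; first by move: n5 cA I2; clear; lia.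
have sumZ (S : {set V * V}) : \sum_i #|Z i :&: S| <= 2 * #|S|.
  have -> : \sum_i #|Z i :&: S| = \sum_(p in S) #|[set i | p \in Z i]|.
    rewrite (eq_bigr (fun i => \sum_(p in S) (p \in Z i))) => [|i _].
      rewrite exchange_big /=; apply: eq_bigr => p _.
      rewrite -sum1_card [RHS]big_mkcond /=; apply: eq_bigr => i _.
      by rewrite inE; case: (_ \in _).
    rewrite -sum1_card [LHS]big_mkcond [RHS]big_mkcond; apply: eq_bigr => p _.
    by rewrite inE; case: (p \in S); case: (p \in Z i).
  by rewrite mulnC -sum_nat_const; apply: leq_sum => p _; exact: Z2.
have s1 : \sum_i #|Z i| <= 2 * #|A|.
  apply: leq_trans (sumZ A); apply: leq_sum => i _.
  by have /even_subP[ZA _ _] := Ze i; rewrite (setIidPl ZA).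
have s2 := sumZ R.
have s3 : 14 * #|I| <= \sum_i (#|Z i| + #|Z i :&: R|) + 4 * \sum_i (Z i \in pentas A R).
  rewrite big_distrr -big_split /= mulnC -sum_nat_const; apply: leq_sum => i _.
  rewrite inE Ze /=; case: (spA.1 _ (Ze i) (Z0 i)); rewrite /wt.
    by move=> ->; rewrite eqxx.
  by move=> h; apply: leq_trans h (leq_addr _ _).
have s4 : \sum_i (Z i \in pentas A R) <= #|pentas A R|.
  have -> : \sum_i (Z i \in pentas A R) = #|[set i | Z i \in pentas A R]|.
    rewrite -sum1_card [RHS]big_mkcond; apply: eq_bigr => i _.
    by rewrite [in RHS]inE; case: (_ \in _).
  rewrite -(card_imset _ Zinj); apply: subset_leq_card.
  by apply/subsetP => _ /imsetP[i + ->]; rewrite inE.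
move: s3; rewrite big_split /=.
move: (\sum_i #|Z i|) (\sum_i #|Z i :&: R|) (\sum_i (Z i \in _)) s1 s2 s4 cA.
by clearbody n; clear; move: #|A| #|R| #|I| #|pentas A R|; lia.
Qed.

Variable C : choiceType.
Variable L : V -> {fset C}.
Hypothesis L5 : forall v, #|` L v| = 5.

Definition odd_colouring A R (f : V -> C) :=
  [/\ forall v, f v \in L v,
      forall u v, (u, v) \in A -> f u <> f v &
      forall v, ~~ relax A R v -> exists c, odd #|[set u in dnbr A v | f u == c]|].

Lemma list_avoid v (s : seq C) : size s <= 4 -> exists2 c, c \in L v & c \notin s.
Proof.
move=> s4; case: (boolP (has (fun c => c \notin s) (L v))) => [/hasP[c cL cs]|/hasPn h].
  by exists c.
have : {subset (L v : seq C) <= s} by move=> c /h; rewrite negbK.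
move/(uniq_leq_size (fset_uniq (L v))); rewrite L5 => h'.
by have := leq_trans h' s4.
Qed.

(** Each neighbour [u] forbids [f u], and if it is not relaxed one further colour [b u]. If some
    colour is odd around [u] without [v], it stays odd unless [v] receives it; if none is, any
    colour given to [v] becomes odd. Hence at most four colours are forbidden in a list of five. *)
Lemma extend_colouring A R v f :
  dsym A -> (forall v, (v, v) \notin A) ->
  (forall x, f x \in L x) ->
  (forall x y, (x, y) \in A -> x != v -> y != v -> f x <> f y) ->
  (forall x, x != v -> x \notin dnbr A v -> ~~ relax A R x ->
     exists c, odd #|[set u in dnbr A x | f u == c]|) ->
  #|dnbr A v| + #|[set u in dnbr A v | ~~ relax A R u]| <= 4 ->
  (relax A R v \/ exists c, odd #|[set u in dnbr A v | f u == c]|) ->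
  exists g, odd_colouring A R g.
Proof.
move=> sA iA fL fp fo d4 fv.
pose k u (x : C) := #|[set w in dnbr A u :\ v | f w == x]|.
have [b bP] : exists b : V -> C, forall u c, c != b u ->
    exists x : C, odd ((c == x) + k u x).
  apply: (fin_all_exists (P := fun u bu => forall c, c != bu ->
    exists x : C, odd ((c == x) + k u x))) => u.
  case: (boolP [exists w, odd (k u (f w))]) => [/existsP[w ow]|noo].
    by exists (f w) => c cw; exists (f w); rewrite (negbTE cw).
  (* In this case every colour works; [f u] is a default that is forbidden anyway. *)
  exists (f u) => c _; exists c; rewrite eqxx oddD /=.
  apply/negP => ok; case/existsP: noo.
  have /card_gt0P[w] : 0 < k u c by case: (k u c) ok.
  by rewrite inE => /andP[_ /eqP E]; exists w; rewrite E.
pose s := flatten [seq f u :: (if relax A R u then [::] else [:: b u])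
                  | u <- enum (dnbr A v)].
have s4 : size s <= 4.
  apply: leq_trans d4; rewrite /s size_flatten /shape -map_comp sumnE big_map.
  rewrite big_enum /= -!sum1_card [X in _ <= _ + X]big_mkcond /=.
  rewrite [X in _ <= X + _]big_mkcond -big_split /= big_mkcond.
  apply: leq_sum => u _; rewrite !inE; case: (_ \in A) => //=.
  by case: (relax A R u).
have [c cL cs] := list_avoid v s4.
have sP u (x : C) : u \in dnbr A v -> x \in f u :: (if relax A R u then [::] else [:: b u]) ->
    c != x.
  move=> uN xs; apply: contraNneq cs => ->; apply/flattenP.
  exists (f u :: (if relax A R u then [::] else [:: b u])) => //.
  by apply/mapP; exists u; rewrite ?mem_enum.
have cf u : u \in dnbr A v -> c != f u.
  by move=> uN; apply: (sP u) => //; rewrite inE eqxx.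
pose g x := if x == v then c else f x.
have gN x (y : C) : v \notin dnbr A x ->
    [set u in dnbr A x | g u == y] = [set u in dnbr A x | f u == y].
  move=> vN; apply/setP => u; rewrite !inE; case: (boolP ((x, u) \in A)) => //= xu.
  by rewrite /g; case: (eqVneq u v) => [E|//]; case/negP: vN; rewrite inE -E.
exists g; split.
- by move=> x; rewrite /g; case: eqP => [->|].
- move=> x y xy; rewrite /g; case: eqP => [xv|/eqP xv]; case: eqP => [yv|/eqP yv].
  + by move: xy; rewrite xv yv (negbTE (iA v)).
  + by apply/eqP/cf; rewrite inE -xv.
  + by apply/eqP; rewrite eq_sym; apply: cf; rewrite inE -yv sA.
  + exact: fp.
- move=> x nr; case: (eqVneq x v) => [xv|xv].
    case: fv => [rv|[c' oc]]; first by rewrite -xv (negbTE nr) in rv.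
    by exists c'; rewrite gN xv // inE; exact: iA.
  case: (boolP (x \in dnbr A v)) => [xN|xN].
    have /bP[y oy] : c != b x.
      by apply: (sP x) => //; rewrite (negbTE nr) !inE eqxx orbT.
    exists y; have vN : v \in dnbr A x by move: xN; rewrite !inE sA.
    suff -> : #|[set u in dnbr A x | g u == y]| = (c == y) + k x y by [].
    rewrite (cardsD1 v) inE vN {1}/g eqxx /=; congr (_ + _); apply: eq_card => u.
    by rewrite !inE /g; case: (eqVneq u v).
  have [y oy] := fo x xv xN nr; exists y; rewrite gN //.
  by move: xN; rewrite !inE sA.
Qed.

Definition del A v := [set p in A | (p.1 != v) && (p.2 != v)].

Lemma in_del A v x y : ((x, y) \in del A v) = [&& (x, y) \in A, x != v & y != v].
Proof. by rewrite inE. Qed.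

Lemma del_sub A v : del A v \subset A.
Proof. by apply/subsetP => p; rewrite inE => /andP[]. Qed.

Lemma del_sym A v : dsym A -> dsym (del A v).
Proof. by move=> sA x y; rewrite !in_del sA; case: (_ \in A) => //=; rewrite andbC. Qed.

Lemma del_card A v u : (v, u) \in A -> #|del A v| < #|A|.
Proof.
move=> vu; apply: proper_card; apply/properP; split; first exact: del_sub.
by exists (v, u) => //; rewrite in_del eqxx andbF.
Qed.

Lemma dnbr_del A v x : dsym A -> x != v -> x \notin dnbr A v ->
  dnbr (del A v) x = dnbr A x.
Proof.
move=> sA xv xN; apply/setP => u; rewrite !inE /= xv /=.
case: (boolP ((x, u) \in A)) => //= xu.
by apply: contraNneq xN => E; rewrite inE sA -E.
Qed.

Lemma even_subW A A' O : A' \subset A -> even_sub A' O -> even_sub A O.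
Proof.
move=> sub /even_subP[OA sO eO]; apply/even_subP; split => //.
exact: subset_trans sub.
Qed.

Lemma del_wt A R v O : O \subset del A v -> wt (del R v) O = wt R O.
Proof.
move=> OA; rewrite /wt; congr (_ + _); apply: eq_card => -[x y].
rewrite !inE; case: (boolP ((x, y) \in O)) => //= /(subsetP OA).
by rewrite in_del => /and3P[_ -> ->]; rewrite !andbT.
Qed.

Lemma del_sparse A R v : sparse A R -> sparse (del A v) (del R v).
Proof.
move=> [s1 s2]; split.
  move=> O eO; have [OA _ _] := even_subP _ _ eO; rewrite (del_wt _ OA).
  by apply: s1; exact: even_subW (del_sub A v) eO.
move=> O1 O2 e1 e2; have [A1 _ _] := even_subP _ _ e1; have [A2 _ _] := even_subP _ _ e2.
rewrite (del_wt _ A1) (del_wt _ A2); apply: s2; exact: even_subW (del_sub A v) _.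
Qed.

Lemma touch_mono (cell side : finType) (src tgt : side -> cell)
    (B B' D D' : {set cell}) e :
  B \subset B' -> D \subset D' -> touch src tgt B D e -> touch src tgt B' D' e.
Proof.
move=> BB DD; rewrite /touch => /orP[]/andP[a b]; apply/orP; [left|right]; apply/andP; split;
  by [apply: (subsetP BB)|apply: (subsetP DD)].
Qed.

Lemma conn_join (cell side : finType) (src tgt : side -> cell) (B D : {set cell}) e :
  conn src tgt B -> conn src tgt D -> touch src tgt B D e ->
  conn src tgt (B :|: D).
Proof.
move=> cB cD te g gE.
have gB := cB g (fun e h1 h2 => gE e (subsetP (subsetUl B D) _ h1) (subsetP (subsetUl B D) _ h2)).
have gD := cD g (fun e h1 h2 => gE e (subsetP (subsetUr B D) _ h1) (subsetP (subsetUr B D) _ h2)).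
have [x [y [xB yD xy]]] : exists x y : cell, [/\ x \in B, y \in D & g x = g y].
  have := gE e; rewrite !inE.
  by case/orP: te => /andP[a b]; rewrite a b ?orbT => /(_ isT isT) E;
    [exists (src e), (tgt e)|exists (tgt e), (src e)].
have gx (z : cell) : z \in B :|: D -> g z = g x.
  by rewrite inE => /orP[zB|zD]; [exact: gB|rewrite xy; exact: gD].
by move=> z z' /gx -> /gx ->.
Qed.

(* A vertex [v] of degree 2 that is not relaxed is replaced by an edge [uw] of R
   joining its neighbours. This keeps all R-lengths, forces different colours on
   [u] and [w], and makes them relaxed until [v] is coloured. *)
Section Suppress.
Variables (A R : {set V * V}) (v u w : V).
Hypotheses (A_sym : dsym A) (A_irr : forall v, (v, v) \notin A).
Hypotheses (RA : R \subset A) (R_sym : dsym R) (spA : sparse A R).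
Hypotheses (uw : u != w) (Nv : dnbr A v = [set u; w]) (Rv : dnbr R v = set0).

Let X := [set (u, w); (w, u)].
Let Y := (u, v) |: ((v, u) |: [set (w, v); (v, w)]).
Let A' := del A v :|: X.
Let R' := R :|: X.

Let X_sym : dsym X.
Proof.
move=> x y; rewrite !in_set2 !xpair_eqE orbC.
by congr (_ || _); rewrite andbC.
Qed.

Lemma sup_vu : (v, u) \in A.
Proof. by have := in_set2 u u w; rewrite -Nv inE eqxx. Qed.

Lemma sup_vw : (v, w) \in A.
Proof. by have := in_set2 w u w; rewrite -Nv inE eqxx orbT. Qed.

Let vu : u != v.
Proof. by apply: contraTneq sup_vu => ->. Qed.
Let vw : w != v.
Proof. by apply: contraTneq sup_vw => ->. Qed.

Let Rv' x : ((v, x) \in R) = false.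
Proof. by move/setP/(_ x): Rv; rewrite !inE. Qed.

(** The triangle [uvw] would have at most the edge [uw] in [R], hence [R]-length at most 4. *)
Lemma sup_nadj : (u, w) \notin A.
Proof.
apply/negP => uwA.
pose S := u |: [set v; w].
have cS : #|S| = 3.
  by rewrite /S cardsU1 cards2 !inE negb_or vu uw [v == w]eq_sym vw.
pose T := [set p | [&& p.1 \in S, p.2 \in S & p.1 != p.2]].
have dT x : dnbr T x = if x \in S then S :\ x else set0.
  apply/setP => y; rewrite inE [in LHS]inE /=; case: ifP => xS; rewrite !inE //=.
  by rewrite andbC eq_sym.
have cT x : x \in S -> #|dnbr T x| = 2.
  by move=> xS; rewrite dT xS; move: cS; rewrite (cardsD1 x) xS => -[].
have TA : T \subset A.
  apply/subsetP => -[x y]; rewrite !inE /= => /and3P[].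
  have := sup_vu; have := sup_vw => vwA vuA.
  have uvA : (u, v) \in A by rewrite A_sym.
  have wvA : (w, v) \in A by rewrite A_sym.
  have wuA : (w, u) \in A by rewrite A_sym.
  by case/or3P => /eqP ->; case/or3P => /eqP -> //; rewrite eqxx.
have eT : even_sub A T.
  apply/even_subP; split => //.
    by move=> x y; rewrite [LHS]inE [RHS]inE /= [x == y]eq_sym andbCA.
  move=> x; case: (boolP (x \in S)) => xS; first by rewrite cT.
  by rewrite dT (negbTE xS) cards0.
have T6 : #|T| = 6.
  rewrite card_darts (bigID (mem S)) /= [X in _ + X]big1 ?addn0.
    by rewrite (eq_bigr (fun=> 2)) ?sum_nat_const ?cS // => x xS; exact: cT.
  by move=> x xS; rewrite dT (negbTE xS) cards0.
have TR : #|T :&: R| <= 2.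
  apply: leq_trans (_ : #|X| <= 2); last by rewrite cards2; case: (_ != _).
  apply: subset_leq_card; apply/subsetP => -[x y].
  rewrite !inE /= => /andP[/and3P[xS yS xy] xyR].
  have xv : x != v by apply: contraTneq xyR => ->; rewrite Rv'.
  have yv : y != v by apply: contraTneq xyR => ->; rewrite R_sym Rv'.
  move: xS yS xy; rewrite (negbTE xv) (negbTE yv) !orFb.
  by case/orP => /eqP ->; case/orP => /eqP ->; rewrite ?eqxx ?orbT.
have T0 : T != set0 by rewrite -card_gt0 T6.
by case: (spA.1 _ eT T0); rewrite /wt T6; move: #|_ :&: _| TR; clear; lia.
Qed.

Lemma sup_sym : dsym A'.
Proof.
by move=> x y; rewrite [LHS]in_setU [RHS]in_setU (del_sym _ A_sym) X_sym.
Qed.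

Lemma sup_irr x : (x, x) \notin A'.
Proof.
rewrite in_setU in_del (negbTE (A_irr x)) in_set2 !xpair_eqE /=.
by apply/negP => /orP[]/andP[/eqP -> /eqP E]; case/eqP: uw.
Qed.

Lemma sup_RA : R' \subset A'.
Proof.
apply: setSU; apply/subsetP => -[x y] xyR; rewrite in_del (subsetP RA) //=.
by apply/andP; split; apply: contraTneq xyR => ->; [|rewrite R_sym]; rewrite Rv'.
Qed.

Lemma sup_Rsym : dsym R'.
Proof.
by move=> x y; rewrite [LHS]in_setU [RHS]in_setU R_sym X_sym.
Qed.

Let cX : #|X| = 2.
Proof. by rewrite cards2 xpair_eqE negb_and uw. Qed.

Let cY : #|Y| = 4.
Proof.
rewrite /Y !cardsU1 cards1 !inE !xpair_eqE.
by rewrite ?(neqE vu) ?(neqE vw) ?(neqE uw) ?andbF.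
Qed.

Lemma sup_card : #|A'| < #|A|.
Proof.
have YA : Y \subset A.
  have := sup_vu; have := sup_vw => vwA vuA.
  by apply/subsetP => p; rewrite !inE => /or4P[]/eqP -> //; rewrite A_sym.
have : #|del A v| <= #|A :\: Y|.
  apply: subset_leq_card; apply/subsetP => -[x y]; rewrite in_setD in_del => /and3P[-> xv yv].
  by rewrite !inE !xpair_eqE (negbTE xv) (negbTE yv) ?andbF.
rewrite cardsD (setIidPr YA) cY; have := subset_leq_card YA; rewrite cY.
have := (leq_card_setU (del A v) X).1; rewrite cX -/A'.
by move: #|A'| #|del A v| #|A|; clear; lia.
Qed.

(** The edge [uw] is replaced by the path [u v w]: two edges outside [R] have the same [R]-length,
    2, as one edge of [R]. *)
Let lift_even O := if (u, w) \in O then (O :\: X) :|: Y else O.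

Let noY O x y : O \subset A' -> (x, y) \in O -> (x != v) && (y != v).
Proof.
move=> OA /(subsetP OA); rewrite in_setU in_del => /orP[/and3P[_ -> ->]//|].
by rewrite !inE !xpair_eqE => /orP[]/andP[/eqP -> /eqP ->]; rewrite vu vw.
Qed.

Let noYd O : O \subset A' -> [disjoint O & Y].
Proof.
move=> OA; apply/pred0P => -[x y] /=; apply: negbTE; apply/negP => /andP[xy].
have /andP[xv yv] := noY OA xy.
by rewrite !inE !xpair_eqE (negbTE xv) (negbTE yv) ?andbF.
Qed.

Let lift_even_sub O : even_sub A' O -> even_sub A (lift_even O).
Proof.
case/even_subP => OA sO eO; rewrite /lift_even; case: ifP => uwO; last first.
  apply/even_subP; split => //; apply/subsetP => -[x y] xy.
  have := subsetP OA _ xy; rewrite in_setU => /orP[/(subsetP (del_sub A v)) //|].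
  rewrite !inE !xpair_eqE => /orP[]/andP[/eqP xE /eqP yE]; move: xy; rewrite xE yE.
    by rewrite uwO.
  by rewrite sO uwO.
have wuO : (w, u) \in O by rewrite sO.
apply/even_subP; split.
- rewrite subUset; apply/andP; split; apply/subsetP => -[x y].
    rewrite in_setD => /andP[xyX /(subsetP OA)]; rewrite in_setU (negbTE xyX) orbF.
    exact: (subsetP (del_sub A v)).
  have := sup_vu; have := sup_vw => vwA vuA.
  by rewrite !inE => /or4P[]/eqP -> //; rewrite A_sym.
- move=> x y; rewrite !inE !xpair_eqE sO.
  case: (x == u); case: (x == v); case: (x == w);
  case: (y == u); case: (y == v); case: (y == w); case: (_ \in O) => //=.
- move=> x.
  have vO y : ((v, y) \in O) = false.
    by apply/negP => /(noY OA); rewrite eqxx.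
  have Ov y : ((y, v) \in O) = false by rewrite sO vO.
  case: (eqVneq x v) => [->|xv].
    have -> : dnbr (O :\: X :|: Y) v = [set u; w].
      apply/setP => y; rewrite !inE !xpair_eqE vO andbF orFb eqxx.
      rewrite ?(neqE vu) ?(neqE vw).
      by case: (y == u); case: (y == w); case: (y == v).
    by rewrite cards2 uw.
  case: (eqVneq x u) => [->|xu].
    have -> : dnbr (O :\: X :|: Y) u = v |: (dnbr O u :\ w).
      apply/setP => y; rewrite !inE !xpair_eqE eqxx ?(neqE uw) ?(neqE vu).
      by case: (y == u); case: (y == w); case: (y == v); case: (_ \in O).
    rewrite cardsU1 !inE Ov andbF add1n.
    by have := eO u; rewrite (cardsD1 w) inE uwO.
  case: (eqVneq x w) => [->|xw].
    have -> : dnbr (O :\: X :|: Y) w = v |: (dnbr O w :\ u).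
      apply/setP => y; rewrite !inE !xpair_eqE eqxx ?(neqE uw) ?(neqE vw).
      by case: (y == u); case: (y == w); case: (y == v); case: (_ \in O).
    rewrite cardsU1 !inE Ov andbF add1n.
    by have := eO w; rewrite (cardsD1 u) inE wuO.
  suff -> : dnbr (O :\: X :|: Y) x = dnbr O x by exact: eO.
  apply/setP => y; rewrite !inE !xpair_eqE (negbTE xv) (negbTE xu) (negbTE xw) /=.
  by rewrite ?orbF.
Qed.

Let XR : [disjoint X & R].
Proof.
apply/pred0P => p /=; apply: negbTE; apply/negP => /andP[pX /(subsetP RA)].
move: pX; rewrite !inE => /orP[]/eqP ->; first by rewrite (negbTE sup_nadj).
by rewrite A_sym (negbTE sup_nadj).
Qed.

Let YR : [disjoint Y & R].
Proof.
apply/pred0P => p /=; apply: negbTE; apply/negP => /andP[pY].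
by move: pY; rewrite !inE => /or4P[]/eqP ->; rewrite ?Rv' // R_sym Rv'.
Qed.

Let lift_wt O : even_sub A' O -> wt R (lift_even O) = wt R' O.
Proof.
case/even_subP => OA sO eO; rewrite /lift_even /wt.
case: ifP => uwO; last first.
  congr (_ + _); apply: eq_card => -[x y].
  rewrite [LHS]in_setI [RHS]in_setI [_ \in R']in_setU.
  case: (boolP ((x, y) \in O)) => //= xy.
  have -> : ((x, y) \in X) = false.
    apply/negP; rewrite !inE !xpair_eqE => /orP[]/andP[/eqP xE /eqP yE]; move: xy;
    by rewrite xE yE ?uwO // sO uwO.
  by rewrite orbF.
have XO : X \subset O.
  by apply/subsetP => p; rewrite !inE => /orP[]/eqP ->; rewrite // sO.
have -> : #|O :\: X :|: Y| = #|O| + 2.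
  rewrite cardsU disjoint_setI0; last first.
    by apply: disjointWl (noYd OA); exact: subsetDl.
  rewrite cards0 subn0 cardsD (setIidPr XO) cX cY.
  by have := subset_leq_card XO; rewrite cX; move: #|O|; clear; lia.
have -> : (O :\: X :|: Y) :&: R = O :&: R.
  apply/setP => p; rewrite [LHS]in_setI [RHS]in_setI in_setU in_setD.
  case: (boolP (p \in R)) => pR; rewrite ?andbF // !andbT.
  by rewrite (disjointFl XR pR) (disjointFl YR pR) orbF.
rewrite setIUr (setIidPr XO) cardsU.
have -> : O :&: R :&: X = set0.
  apply/eqP; rewrite -subset0; apply/subsetP => p; rewrite !in_setI => /andP[/andP[_ pR] pX].
  by rewrite (disjointFl XR pR) in pX.
by rewrite cards0 subn0 cX addnAC addnA.
Qed.

(** Lifting preserves weights and is injective, and a dart common to two even sets yields one common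
    to their lifts; for a dart of the new edge this is [(u, v)]. *)
Lemma sup_sparse : sparse A' R'.
Proof.
have sA' O : even_sub A' O -> O \subset A' by case/even_subP.
have YuO O : even_sub A' O -> ((u, v) \in lift_even O) = ((u, w) \in O).
  move=> eO; rewrite /lift_even; case: ifP => h; first by rewrite !inE eqxx ?orbT.
  by apply/negP => /(noY (sA' _ eO)); rewrite eqxx andbF.
have Xin O p : even_sub A' O -> p \in X -> (p \in O) = ((u, w) \in O).
  by case/even_subP => _ sO _; rewrite !inE => /orP[]/eqP -> //; rewrite sO.
have noX O p : p \in O -> p \notin X -> p \in lift_even O.
  by move=> pO pX; rewrite /lift_even; case: ifP => // _; rewrite in_setU in_setD pO pX.
have back O p : even_sub A' O -> p.1 != v -> p.2 != v -> p \notin X ->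
    p \in lift_even O -> p \in O.
  move=> eO p1 p2 pX; rewrite /lift_even; case: ifP => // _.
  rewrite in_setU in_setD => /orP[/andP[] //|].
  by case: p p1 p2 {pX} => x y /= xv yv; rewrite !inE !xpair_eqE (negbTE xv) (negbTE yv) ?andbF.
have subl O1 O2 : even_sub A' O1 -> even_sub A' O2 -> lift_even O1 = lift_even O2 ->
    O1 \subset O2.
  move=> e1 e2 E; apply/subsetP => -[x y] p1.
  case: (boolP ((x, y) \in X)) => pX.
    by move: p1; rewrite !(Xin _ _ _ pX) // -!YuO // E.
  have /andP[xv yv] := noY (sA' _ e1) p1.
  by apply: back => //; rewrite -E; exact: noX.
split.
  move=> O eO O0; rewrite -lift_wt //; apply: spA.1; first exact: lift_even_sub.
  rewrite /lift_even; case: ifP => // _; apply/set0Pn; exists (u, v).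
  by rewrite !inE eqxx ?orbT.
move=> O1 O2 e1 e2; rewrite -!lift_wt // => w1 w2 ne.
have ne' : lift_even O1 != lift_even O2.
  by apply: contra ne => /eqP E; rewrite eqEsubset !subl.
have dis := spA.2 _ _ (lift_even_sub e1) (lift_even_sub e2) w1 w2 ne'.
apply/pred0P => p /=; apply: negbTE; apply/negP => /andP[p1 p2].
case: (boolP (p \in X)) => pX.
  have q1 : (u, v) \in lift_even O1 by rewrite YuO // -(Xin _ p).
  by have := disjointFr dis q1; rewrite YuO // -(Xin _ p) // p2.
by have := disjointFr dis (noX _ _ p1 pX); rewrite noX.
Qed.

(** The edge [uv] is contracted: the branch set of [v] goes to [u], and [v] is left with the empty
    set. *)
Lemma sup_minor (cell side : finType) (src tgt : side -> cell) :
  minor_model src tgt A -> minor_model src tgt A'.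
Proof.
case=> B [Bd Bc Bt].
pose B' x := if x == u then B u :|: B v else if x == v then set0 else B x.
have B'u : B' u = B u :|: B v by rewrite /B' eqxx.
have B'x x : x != u -> x != v -> B' x = B x.
  by rewrite /B' => /negbTE -> /negbTE ->.
have dj x : x != u -> [disjoint B u :|: B v & B' x].
  move=> xu; rewrite /B' (negbTE xu); case: (eqVneq x v) => xv.
    by rewrite disjoint_sym disjoints_subset sub0set.
  rewrite -setI_eq0 setIUl setU_eq0 !setI_eq0.
  by apply/andP; split; apply: Bd; rewrite eq_sym.
exists B'; split.
- move=> x y xy; case: (eqVneq x u) => [E|xu].
    by rewrite E B'u; apply: dj; rewrite -E eq_sym.
  case: (eqVneq y u) => [E|yu].
    by rewrite E B'u disjoint_sym; exact: dj.
  rewrite /B' (negbTE xu) (negbTE yu).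
  case: (x == v); first by rewrite disjoints_subset sub0set.
  case: (y == v); first by rewrite disjoint_sym disjoints_subset sub0set.
  exact: Bd.
- move=> x; case: (eqVneq x u) => [E|xu].
    have uvA : (u, v) \in A by rewrite A_sym sup_vu.
    rewrite E B'u; have [e te] := Bt _ _ uvA; exact: conn_join te.
  rewrite /B' (negbTE xu); case: eqP => // _ g _ y z; by rewrite inE.
- have BB x : x != v -> B x \subset B' x.
    by move=> xv; rewrite /B' (negbTE xv); case: eqP => // ->; exact: subsetUl.
  have vB : B v \subset B' u by rewrite B'u subsetUr.
  move=> x y; rewrite in_setU in_del => /orP[/and3P[xy xv yv]|].
    by have [e te] := Bt _ _ xy; exists e; apply: touch_mono te; exact: BB.
  have [e te] := Bt _ _ sup_vw.
  rewrite !inE !xpair_eqE => /orP[]/andP[/eqP -> /eqP ->]; exists e.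
    by apply: touch_mono te => //; exact: BB.
  by rewrite touchC; apply: touch_mono te => //; exact: BB.
Qed.

Lemma sup_dnbr x : x != v -> x \notin dnbr A v ->
  dnbr A' x = dnbr A x /\ dnbr R' x = dnbr R x.
Proof.
move=> xv xN; have xN' := xN; rewrite Nv !inE negb_or in xN'.
case/andP: xN' => xu xw.
have E y : ((x, y) \in X) = false by rewrite !inE !xpair_eqE (negbTE xu) (negbTE xw).
split; last by apply/setP => y; rewrite inE in_setU E orbF inE.
by rewrite -(dnbr_del A_sym xv xN); apply/setP => y; rewrite inE in_setU E orbF [in RHS]inE.
Qed.

(** The two neighbours of [v] forbid at most two colours each, and [f u] occurs exactly once around
    [v]. *)
Lemma sup_colouring f : ~~ relax A R v -> odd_colouring A' R' f ->
  exists g, odd_colouring A R g.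
Proof.
move=> nrv [fL fp fo]; apply: (@extend_colouring _ _ v f) => //.
- by move=> x y xy xv yv; apply: fp; rewrite in_setU in_del xy xv yv.
- move=> x xv xN nr; have [E1 E2] := sup_dnbr xv xN.
  by have := fo x; rewrite /relax E1 E2; apply.
- rewrite Nv cards2 uw; set S := [set _ in _ | _].
  have : #|S| <= #|[set u; w]|.
    by apply: subset_leq_card; apply/subsetP => x; rewrite inE => /andP[].
  by rewrite cards2 uw; move: #|S|; clear; lia.
right; exists (f u); rewrite Nv.
have -> : [set x in [set u; w] | f x == f u] = [set u].
  apply/setP => x; rewrite !inE; case: (eqVneq x u) => [->|xu] /=; first by rewrite eqxx.
  apply/negP => /andP[/eqP -> /eqP E].
  have : (u, w) \in A' by rewrite in_setU !inE eqxx orbT.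
  by move/fp => /(_ (esym E)).
by rewrite cards1.
Qed.

End Suppress.

Variables cell side corner : finType.
Variables (src tgt : side -> cell) (lft rgt : side -> corner).
Hypothesis cplx : closed_complex src tgt lft rgt.

Theorem odd_colouring_exists A R : dsym A -> (forall v, (v, v) \notin A) ->
  R \subset A -> dsym R -> sparse A R -> minor_model src tgt A ->
  exists f, odd_colouring A R f.
Proof.
have [n] := ubnP #|A|; elim: n A R => // n IH A R; rewrite ltnS => An.
move=> A_sym A_irr RA R_sym spA mA.
have [A0|A0] := eqVneq A set0.
  have N0 v : dnbr A v = set0 by apply/setP => u; rewrite A0 !inE.
  have [f fP] : exists f : V -> C, forall v, f v \in L v.
    apply: (fin_all_exists (P := fun v c => c \in L v)) => v.
    by have [c cL _] := list_avoid v (isT : size ([::] : seq C) <= 4); exists c.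
  exists f; split => //; first by move=> u v; rewrite A0 inE.
  by move=> v; rewrite /relax N0 cards0 orbT.
case: (boolP [exists v, [&& dnbr A v != set0, relax A R v &
    #|dnbr A v| + #|[set u in dnbr A v | ~~ relax A R u]| <= 4]]).
  case/existsP => v /and3P[/set0Pn[u]]; rewrite inE => vu rv d4.
  have [|||||||f [fL fp fo]] := IH (del A v) (del R v).
  - exact: leq_trans (del_card vu) An.
  - exact: del_sym.
  - by move=> x; rewrite in_del (negbTE (A_irr x)).
  - by apply/subsetP => -[x y]; rewrite !in_del => /and3P[/(subsetP RA) -> -> ->].
  - exact: del_sym.
  - exact: del_sparse.
  - case: mA => B [Bd Bc Bt]; exists B; split => // x y.
    by move/(subsetP (del_sub A v)); exact: Bt.
  apply: (@extend_colouring _ _ v f) => //; last by left.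
    by move=> x y xy xv yv; apply: fp; rewrite in_del xy xv yv.
  move=> x xv xN nr; have := fo x; rewrite /relax (dnbr_del A_sym xv xN).
  apply; apply: contra nr => /or3P[h|h|h]; rewrite /relax ?h ?orbT //.
  by case/set0Pn: h => y; rewrite inE => /(subsetP (del_sub R v)) h;
    apply/or3P; constructor 3; apply/set0Pn; exists y; rewrite inE.
rewrite negb_exists => /forallP red1.
case: (boolP [exists v, ~~ relax A R v && (#|dnbr A v| < 4)]).
  case/existsP => v /andP[nrv d4].
  have d2 : #|dnbr A v| = 2.
    move: (nrv); rewrite /relax !negb_or; case: #|dnbr A v| d4 => [|[|[|[|]]]] //.
  have /cards2P[u [w [uw Nv]]] : #|dnbr A v| == 2 by rewrite d2.
  have Rv : dnbr R v = set0.
    by move: nrv; rewrite /relax !negb_or negbK => /and3P[_ _ /eqP].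
  have [|||||||f fP] := IH (del A v :|: [set (u, w); (w, u)]) (R :|: [set (u, w); (w, u)]).
  - exact: leq_trans (sup_card A_sym A_irr uw Nv) An.
  - exact: sup_sym.
  - exact: sup_irr.
  - exact: sup_RA.
  - exact: sup_Rsym.
  - exact: sup_sparse.
  - exact: sup_minor.
  exact: sup_colouring nrv fP.
rewrite negb_exists => /forallP red2.
have relaxed_deg v : dnbr A v != set0 -> relax A R v ->
    5 <= #|dnbr A v| + #|[set u in dnbr A v | ~~ relax A R u]|.
  by move=> v0 rv; have := red1 v; rewrite v0 rv /= -ltnNge.
have nonrelaxed_deg v : ~~ relax A R v -> 4 <= #|dnbr A v|.
  by move=> nr; have := red2 v; rewrite nr /= -leqNgt.
have lt := discharge A_sym A_irr RA R_sym spA relaxed_deg nonrelaxed_deg A0.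
set NI := [set v | dnbr A v != set0] in lt *.
have inNI x y : (x, y) \in A -> (x \in NI) && (y \in NI).
  move=> xy; rewrite !inE; apply/andP; split; apply/set0Pn; first by exists y; rewrite inE.
  by exists x; rewrite inE A_sym.
have [[u0 v0] uv0] := set0Pn _ A0.
(* A relaxed vertex of degree at most 3 has a neighbour that is not relaxed, hence of degree at
   least 4. Together with its neighbours it supplies five vertices that are not isolated. *)
have [v vd] : exists v, 4 <= #|dnbr A v|.
  case: (ltnP 3 #|dnbr A u0|) => [|d3]; first by exists u0.
  have u00 : dnbr A u0 != set0 by apply/set0Pn; exists v0; rewrite inE.
  case: (boolP (relax A R u0)) => [ru|/nonrelaxed_deg h]; last by exists u0.
  have := relaxed_deg _ u00 ru => h.
  have /card_gt0P[q] : 0 < #|[set u in dnbr A u0 | ~~ relax A R u]|.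
    by move: h d3; clear; lia.
  by rewrite inE => /andP[_ /nonrelaxed_deg]; exists q.
have n5 : 5 <= #|NI|.
  apply: leq_trans (_ : #|v |: dnbr A v| <= _).
    by rewrite cardsU1 inE (negbTE (A_irr v)).
  have /card_gt0P[y] : 0 < #|dnbr A v| by exact: leq_trans vd.
  rewrite inE => vy; apply: subset_leq_card; apply/subsetP => x.
  rewrite in_setU1 => /orP[/eqP ->|]; first by case/andP: (inNI _ _ vy).
  by rewrite [x \in dnbr A v]inE => /inNI/andP[].
have := euler_bound cplx A_sym A_irr spA RA mA n5.
by rewrite leqNgt lt.
Qed.

End Induction.

(** * From cycles to even sets of darts *)

Section GraphDarts.
Variable G : sgraph.

Definition darts : {set G * G} := [set p | adj p.1 p.2]%SET.

Lemma darts_sym : dsym darts.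
Proof. by move=> x y; rewrite !inE /= adj_sym. Qed.

Lemma darts_irr v : (v, v) \notin darts.
Proof. by rewrite inE /= adj_irr. Qed.

Lemma set2_inj (u v u' v' : G) : [set u; v]%SET = [set u'; v']%SET ->
  (u = u' /\ v = v') \/ (u = v' /\ v = u').
Proof.
move=> E.
have : u \in [set u'; v']%SET by rewrite -E !inE eqxx.
have : v \in [set u'; v']%SET by rewrite -E !inE eqxx orbT.
have : u' \in [set u; v]%SET by rewrite E !inE eqxx.
have : v' \in [set u; v]%SET by rewrite E !inE eqxx orbT.
rewrite !inE => /orP[]/eqP h1 /orP[]/eqP h2 /orP[]/eqP h3 /orP[]/eqP h4; subst; by [left|right].
Qed.

End GraphDarts.

Section Cycles.
Variables (G : sgraph) (R : {set {set G}}).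
Hypothesis R_edges : R \subset edges G.

Definition end_set (p : G * G) : {set G} := [set p.1; p.2]%SET.
Definition Rdarts : {set G * G} := [set p | end_set p \in R]%SET.
Definition cycle_darts (c : seq G) : {set G * G} :=
  [set p | [&& p.1 \in c, p.2 \in c & (p.2 == next c p.1) || (p.1 == next c p.2)]]%SET.

Lemma end_setC x y : end_set (x, y) = end_set (y, x).
Proof. by rewrite /end_set setUC. Qed.

Lemma Rdarts_sym : dsym Rdarts.
Proof. by move=> x y; rewrite !inE end_setC. Qed.

Lemma Rdarts_sub : Rdarts \subset darts G.
Proof.
apply/subsetP => -[x y]; rewrite !inE => /(subsetP R_edges)/imsetP[[u v]].
rewrite inE /= => uv /set2_inj /= [] [-> ->] //.
by rewrite adj_sym.
Qed.

Lemma card_end_set (O : {set G * G}) : dsym O -> (forall v, (v, v) \notin O) ->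
  #|O| = 2 * #|end_set @: O|.
Proof.
move=> sO iO; rewrite -sum1_card (partition_big_imset end_set) /=.
rewrite mulnC -sum_nat_const; apply: eq_bigr => _ /imsetP[[x y] xy ->].
have xNy : x != y by apply: contraTneq xy => ->.
rewrite sum1_card -[RHS](_ : #|[set (x, y); (y, x)]%SET| = 2); last first.
  by rewrite cards2 xpair_eqE negb_and xNy.
apply: eq_card => -[u v]; rewrite !inE unfold_in /=.
apply/andP/orP => [[uv /eqP/set2_inj /= [] [-> ->]]|[]/eqP[-> ->]].
- by left.
- by right.
- by [].
- by rewrite -sO end_setC.
Qed.

Section OneCycle.
Variable c : seq G.
Hypothesis cc : is_cycle c.

Let c_cycle : cycle (@adj G) c. Proof. by case/andP: cc => /andP[]. Qed.
Let c_uniq : uniq c. Proof. by case/andP: cc => /andP[]. Qed.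
Let c_size : 2 < size c. Proof. by case/andP: cc. Qed.

Lemma cycle_darts_sym : dsym (cycle_darts c).
Proof. by move=> x y; rewrite !inE /= andbCA orbC. Qed.

Lemma next_neq_prev x : x \in c -> next c x != prev c x.
Proof.
move=> xc; apply/eqP => E.
have : next c (next c x) = x by rewrite E next_prev.
have [i s Es] := rot_to xc.
have us : uniq (x :: s) by rewrite -Es rot_uniq.
have ss : 2 < size (x :: s) by rewrite -Es size_rot.
have nE y : next c y = next (x :: s) y by rewrite -Es next_rot.
rewrite !nE; case: s us ss {Es nE} => [|y [|z s]] //= us _.
move: us; rewrite !inE !negb_or => /andP[/and3P[xy xz _] _].
by rewrite eqxx [y == x]eq_sym (negbTE xy) eqxx => E2; rewrite E2 eqxx in xz.
Qed.

Lemma dnbr_cycle x : x \in c -> dnbr (cycle_darts c) x = [set next c x; prev c x]%SET.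
Proof.
move=> xc; apply/setP => y; rewrite !inE /= xc /=.
apply/andP/orP => [[yc /orP[/eqP ->|/eqP E]]|[/eqP ->|/eqP ->]].
- by left.
- by right; rewrite E prev_next.
- by rewrite mem_next xc eqxx.
- by rewrite mem_prev xc next_prev // eqxx orbT.
Qed.

Lemma dnbr_cycleN x : x \notin c -> dnbr (cycle_darts c) x = set0.
Proof. by move=> xc; apply/setP => y; rewrite !inE /= (negbTE xc). Qed.

Lemma cycle_darts_sub (O : {set G * G}) : dsym O ->
  cycle (fun x y => (x, y) \in O) c -> cycle_darts c \subset O.
Proof.
move=> sO cO; apply/subsetP => -[x y]; rewrite inE /= => /and3P[xc yc /orP[/eqP ->|/eqP ->]].
  exact: (next_cycle cO).
by rewrite sO; exact: (next_cycle cO).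
Qed.

Lemma cycle_darts_even : even_sub (darts G) (cycle_darts c).
Proof.
apply/even_subP; split.
- apply: cycle_darts_sub; first exact: darts_sym.
  by apply: sub_cycle c_cycle => x y xy; rewrite inE.
- exact: cycle_darts_sym.
- move=> x; case: (boolP (x \in c)) => xc; last by rewrite dnbr_cycleN // cards0.
  by rewrite dnbr_cycle // cards2 next_neq_prev.
Qed.

Lemma cycle_darts_irr x : (x, x) \notin cycle_darts c.
Proof.
have [/subsetP sub _ _] := even_subP _ _ cycle_darts_even.
by apply/negP => /sub; rewrite (negbTE (darts_irr x)).
Qed.

Lemma end_set_cycle : (end_set @: cycle_darts c)%SET = cycle_edges c.
Proof.
apply/setP => e; apply/imsetP/imsetP => [[[x y]]|[x xc ->]].
  rewrite inE /= => /and3P[xc yc /orP[/eqP E|/eqP E]] ->.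
    by exists x => //; rewrite /end_set /= E.
  by exists y => //; rewrite end_setC /end_set /= E.
by exists (x, next c x) => //; rewrite inE /= mem_next xc eqxx.
Qed.

Lemma end_setI (O O' : {set G * G}) : dsym O -> dsym O' ->
  (end_set @: (O :&: O') = (end_set @: O) :&: (end_set @: O'))%SET.
Proof.
move=> sO sO'; apply/setP => e; rewrite inE; apply/imsetP/andP.
  case=> p; rewrite inE => /andP[pO pO'] ->.
  by split; apply/imsetP; exists p.
case=> /imsetP[[x y] xy ->] /imsetP[[u v] uv E]; exists (x, y) => //.
rewrite inE xy /=; case: (set2_inj E) => /= -[-> ->] //.
by rewrite sO'.
Qed.

Lemma end_setIR (O : {set G * G}) :
  (end_set @: (O :&: Rdarts) = (end_set @: O) :&: R)%SET.
Proof.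
apply/setP => e; rewrite inE; apply/imsetP/andP.
  case=> p; rewrite !inE => /andP[pO pR] ->; split => //.
  by apply/imsetP; exists p.
by case=> /imsetP[p pO ->] pR; exists p => //; rewrite !inE pO.
Qed.

Lemma wt_cycle : wt Rdarts (cycle_darts c) = 2 * Rlength R c.
Proof.
rewrite /wt /Rlength mulnDr -end_set_cycle -end_setIR; congr (_ + _).
  by apply: card_end_set; [exact: cycle_darts_sym|exact: cycle_darts_irr].
apply: card_end_set.
  by move=> x y; rewrite inE cycle_darts_sym Rdarts_sym [in RHS]inE.
by move=> x; rewrite inE (negbTE (cycle_darts_irr x)).
Qed.

Lemma Rlength_ge3 : 3 <= Rlength R c.
Proof.
apply: leq_trans (leq_addr _ _).
have : #|cycle_darts c| = 2 * #|cycle_edges c|.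
  rewrite -end_set_cycle; apply: card_end_set; [exact: cycle_darts_sym|exact: cycle_darts_irr].
rewrite card_darts (bigID [in c]) /= [X in _ + X]big1 ?addn0; last first.
  by move=> x xc; rewrite dnbr_cycleN // cards0.
rewrite (eq_bigr (fun=> 2)) => [|x xc]; last by rewrite dnbr_cycle // cards2 next_neq_prev.
rewrite sum_nat_const (card_uniqP c_uniq).
by move: c_size; clear; lia.
Qed.

End OneCycle.

(** A path in [O] is extended at its head [x], which by evenness has a neighbour other than the next
    vertex [z]. If that neighbour is already on the path it closes a cycle; [k] bounds the number of
    extensions left. *)
Lemma even_cycle (O : {set G * G}) : even_sub (darts G) O -> O != set0 ->
  exists2 c, is_cycle c & cycle_darts c \subset O.
Proof.
move=> eO /set0Pn[[x0 y0] xy0]; have [OA sO _] := even_subP _ _ eO.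
have grow k : forall x z p, path (fun x y => (x, y) \in O) x (z :: p) ->
    uniq (x :: z :: p) -> #|G| - size p <= k ->
    exists2 c, is_cycle c & cycle_darts c \subset O.
  elim: k => [|k IH] x z p pth us lek.
    have : size (x :: z :: p) <= #|G| by rewrite -(card_uniqP us) max_card.
    by move: lek; rewrite /=; move: #|G|; clear; lia.
  have xz : (x, z) \in O by case/andP: pth.
  have [y yz xy] := even_second eO xz.
  have yx : y != x.
    by apply: contraTneq (subsetP OA _ xy) => ->; exact: darts_irr.
  case: (boolP (y \in z :: p)) => [yp|yp]; last first.
    apply: (IH y x (z :: p)); first by rewrite /= -sO xy; exact: pth.
      by rewrite cons_uniq us inE negb_or yx yp.
    have : size (x :: z :: p) <= #|G| by rewrite -(card_uniqP us) max_card.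
    by move: lek; rewrite /=; move: #|G|; clear; lia.
  have {}yp : y \in p by move: yp; rewrite inE (negbTE yz).
  case/splitPr: p / yp pth us {lek} => p1 p2 pth us.
  have cO : cycle (fun x y => (x, y) \in O) (x :: z :: rcons p1 y).
    move: pth; rewrite /= cat_path rcons_path rcons_path last_rcons => /and3P[-> -> /andP[-> _]].
    by rewrite sO xy.
  exists (x :: z :: rcons p1 y); last exact: cycle_darts_sub.
  rewrite /is_cycle /= size_rcons andbT; apply/andP; split.
    apply: sub_path cO => a b /(subsetP OA); by rewrite inE.
  by move: us; rewrite -cat_rcons -!cat_cons cat_uniq => /and3P[].
have [y1 yy xy1] := even_second eO xy0.
apply: (grow #|G| x0 y0 [::]); last by rewrite leq_subr.
  by rewrite /= xy0.
rewrite /= inE andbT; apply: contraTneq (subsetP OA _ xy0) => ->; exact: darts_irr.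
Qed.

Lemma wtD (O O' : {set G * G}) : O' \subset O ->
  wt Rdarts O = wt Rdarts O' + wt Rdarts (O :\: O')%SET.
Proof.
move=> sub; rewrite /wt -(cardsID O' O) (setIidPr sub).
rewrite -(cardsID O' (O :&: Rdarts)%SET).
have -> : (O :&: Rdarts :&: O' = O' :&: Rdarts)%SET.
  by rewrite setIAC (setIidPr sub).
have -> : ((O :&: Rdarts) :\: O' = (O :\: O') :&: Rdarts)%SET.
  by apply/setP => p; rewrite !inE andbA.
by clear; lia.
Qed.

Lemma even_subD (O O' : {set G * G}) : even_sub (darts G) O -> even_sub (darts G) O' ->
  O' \subset O -> even_sub (darts G) (O :\: O')%SET.
Proof.
move=> /even_subP[OA sO eO] /even_subP[OA' sO' eO'] sub; apply/even_subP; split.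
- exact: subset_trans (subsetDl _ _) OA.
- by move=> x y; rewrite !inE sO sO'.
- move=> v.
  have -> : dnbr (O :\: O')%SET v = (dnbr O v :\: dnbr O' v)%SET.
    by apply/setP => u; rewrite !inE.
  have sub' : dnbr O' v \subset dnbr O v.
    by apply/subsetP => u; rewrite !inE; exact: (subsetP sub).
  by rewrite cardsD (setIidPr sub') oddB ?subset_leq_card // negb_add (negbTE (eO v)) (negbTE (eO' v)).
Qed.

Hypothesis no_346 : forall c : seq G, is_cycle c ->
  [/\ Rlength R c <> 3, Rlength R c <> 4 & Rlength R c <> 6].
Hypothesis no_55 : forall c1 c2 : seq G, is_cycle c1 -> is_cycle c2 ->
  Rlength R c1 = 5 -> Rlength R c2 = 5 ->
  #|cycle_edges c1 :&: cycle_edges c2| <> 1.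

(** Remove a cycle: if anything is left, it is even and contains a second cycle with no common edge,
    and each has weight at least 10. *)
Lemma even_cycle_or_big (O : {set G * G}) : even_sub (darts G) O -> O != set0 ->
  20 <= wt Rdarts O \/ exists2 c, is_cycle c & O = cycle_darts c.
Proof.
move=> eO O0; have [c cc cO] := even_cycle eO O0.
have eC := cycle_darts_even cc.
have big c' : is_cycle c' -> 10 <= wt Rdarts (cycle_darts c').
  move=> cc'; rewrite wt_cycle //; have := Rlength_ge3 cc'; have [] := no_346 cc'.
  by clear; lia.
case: (eqVneq (O :\: cycle_darts c)%SET set0) => [E|nE].
  right; exists c => //; apply/eqP; rewrite eqEsubset cO andbT.
  by rewrite -setD_eq0 E.
left; have eD := even_subD eO eC cO.
have [c' cc' cO'] := even_cycle eD nE.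
rewrite (wtD cO) (wtD cO') addnA -[20]/(10 + 10).
apply: leq_trans (leq_addr _ _); apply: leq_add; exact: big.
Qed.

(** If two distinct pentagons share [e] edges, [r] of them in [R], their symmetric difference is a
    nonempty even set of weight [20 - 4 (e + r)]. With [e >= 1] the only admissible value is 16, so
    exactly one edge is shared, against [no_55]. *)
Lemma cycles_sparse : sparse (darts G) Rdarts.
Proof.
have H1 O : even_sub (darts G) O -> O != set0 ->
    wt Rdarts O = 10 \/ 14 <= wt Rdarts O.
  move=> eO O0; have [h|[c cc ->]] := even_cycle_or_big eO O0.
    by right; exact: leq_trans h.
  rewrite wt_cycle //; have := Rlength_ge3 cc; have [] := no_346 cc.
  by clear; lia.
split => // O1 O2 e1 e2 w1 w2 ne.
rewrite -setI_eq0; apply: contraT => I0.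
have cyc O : even_sub (darts G) O -> wt Rdarts O = 10 ->
    exists c, [/\ is_cycle c, O = cycle_darts c & Rlength R c = 5].
  move=> eO w.
  have O0 : O != set0.
    by apply: contra_eq_neq w => ->; rewrite /wt set0I cards0.
  have [h|[c cc E]] := even_cycle_or_big eO O0; first by rewrite w in h.
  exists c; split => //; move: w; rewrite E wt_cycle //; clear; lia.
have [c1 [cc1 E1 l1]] := cyc _ e1 w1; have [c2 [cc2 E2 l2]] := cyc _ e2 w2.
have [A1 s1 ev1] := even_subP _ _ e1; have [A2 s2 ev2] := even_subP _ _ e2.
pose I := (O1 :&: O2)%SET; pose S := ((O1 :\: O2) :|: (O2 :\: O1))%SET.
have irr (O : {set G * G}) : O \subset darts G -> forall v, (v, v) \notin O.
  by move=> OA v; apply/negP => /(subsetP OA); rewrite (negbTE (darts_irr v)).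
have sI : dsym I by move=> x y; rewrite !inE s1 s2.
have IA : I \subset darts G by apply: subset_trans (subsetIl _ _) A1.
have eS : even_sub (darts G) S.
  apply/even_subP; split.
  - by rewrite subUset !(subset_trans (subsetDl _ _)).
  - by move=> x y; rewrite !inE s1 s2.
  - move=> v.
    have -> : dnbr S v = ((dnbr O1 v :\: dnbr O2 v) :|: (dnbr O2 v :\: dnbr O1 v))%SET.
      by apply/setP => u; rewrite !inE.
    rewrite cardsU.
    have -> : ((dnbr O1 v :\: dnbr O2 v) :&: (dnbr O2 v :\: dnbr O1 v) = set0)%SET.
      by apply/setP => u; rewrite !inE; case: ((v, u) \in O1); case: ((v, u) \in O2).
    rewrite cards0 subn0 oddD !cardsD !oddB ?subset_leq_card ?subsetIl //.
    by rewrite (negbTE (ev1 v)) (negbTE (ev2 v)) setIC addbb.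
have wS : wt Rdarts S + 2 * wt Rdarts I = 20.
  have h1 : wt Rdarts (O1 :\: O2)%SET + wt Rdarts I = 10.
    have := @wtD O1 I (subsetIl _ _); rewrite w1 /I setDIr setDv set0U.
    by move=> ->; rewrite addnC.
  have h2 : wt Rdarts (O2 :\: O1)%SET + wt Rdarts I = 10.
    have := @wtD O2 I (subsetIr _ _); rewrite w2 /I setDIr setDv setU0.
    by move=> ->; rewrite addnC.
  have h3 : wt Rdarts S = wt Rdarts (O1 :\: O2)%SET + wt Rdarts (O2 :\: O1)%SET.
    rewrite (@wtD S (O1 :\: O2)%SET (subsetUl _ _)); congr (_ + wt _ _).
    by apply/setP => p; rewrite !inE; case: (p \in O1); case: (p \in O2).
  by move: h1 h2; rewrite h3; clear; lia.
have S0 : S != set0.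
  apply: contra ne => /eqP E; apply/eqP/setP => p.
  by move/setP/(_ p): E; rewrite !inE; case: (p \in O1); case: (p \in O2).
have cI : #|I| = 2 * #|(end_set @: I)%SET| by apply: card_end_set => //; exact: irr.
have cIR : #|(I :&: Rdarts)%SET| = 2 * #|(end_set @: (I :&: Rdarts))%SET|.
  apply: card_end_set; first by move=> x y; rewrite inE sI Rdarts_sym [in RHS]inE.
  by move=> v; rewrite inE (negbTE (irr _ IA v)).
have I1 : 0 < #|I| by rewrite card_gt0.
have one : #|(end_set @: I)%SET| = 1.
  have := H1 _ eS S0; move: wS; rewrite {2}/wt.
  move: cI cIR I1; move: (wt _ S) #|I| #|(I :&: Rdarts)%SET|.
  by move: #|(end_set @: I)%SET| #|(end_set @: (I :&: Rdarts))%SET|; clear; lia.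
by case: (no_55 cc1 cc2 l1 l2); rewrite -!end_set_cycle // -end_setI ?E1 ?E2 -?E1 -?E2.
Qed.

Lemma relaxedE v : relaxed R v = relax (darts G) Rdarts v.
Proof.
have nE : dnbr (darts G) v = nbhd v by apply/setP => u; rewrite !inE.
rewrite /relaxed /relax nE; congr [|| _, _ | _].
apply/existsP/set0Pn => [[e /andP[eR ve]]|[u]].
  have /imsetP[[x y]] := subsetP R_edges _ eR; rewrite inE /= => xy eE.
  move: ve eR; rewrite eE !inE => /orP[]/eqP -> eR.
    by exists y; rewrite !inE.
  by exists x; rewrite !inE end_setC.
by rewrite !inE => h; exists (end_set (v, u)); rewrite h /= !inE eqxx.
Qed.

End Cycles.

(** * Square grids on the torus and the Klein bottle *)

Section Grid.
Variables (n : nat) (flip : bool).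
Local Notation I := 'I_n.+1.

Definition gcell : finType := (I * I)%type.
Definition gside : finType := (gcell * bool)%type.

Definition upc (c : gcell) : gcell := (c.1, ordS c.2).
Definition rightc (c : gcell) : gcell :=
  (ordS c.1, if flip && (c.1 == ord_max) then rev_ord c.2 else c.2).

Definition gsrc (e : gside) : gcell := e.1.
Definition gtgt (e : gside) : gcell := if e.2 then upc e.1 else rightc e.1.

(* Corners are named by the cell of which they are the top right vertex. *)
Definition glft (e : gside) : gcell := e.1.
(** The top left vertex of a cell is the top right vertex of its left neighbour. Across the reversed
    seam it is the bottom right vertex of the neighbour, whence the additional [ord_pred]. *)
Definition grgt (e : gside) : gcell :=
  if e.2 then (ord_pred e.1.1,
               if flip && (e.1.1 == ord0) then ord_pred (rev_ord e.1.2) else e.1.2)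
  else (e.1.1, ord_pred e.1.2).

(** Top vertices of row [j] become bottom vertices of row [rev_ord j] across the reversed seam, that
    is, top vertices of row [rev_ord (ordS j)]; this shift distinguishes it from [rightc]. *)
Definition rightcorner (f : gcell) : gcell :=
  (ordS f.1, if flip && (f.1 == ord_max) then rev_ord (ordS f.2) else f.2).

Lemma ordS_rev (j : I) : ordS (rev_ord (ordS j)) = rev_ord j.
Proof.
apply: val_inj => /=.
have := ltn_ord j; rewrite ltnS leq_eqVlt => /orP[/eqP jn|jn].
  by rewrite jn modnn subSS subn0 subnn modnn.
rewrite (modn_small (m := j.+1)) ?ltnS // !subSS modn_small; first by lia.
by have := ltn_ord j; lia.
Qed.

Lemma ordS_max (j : I) : (ordS j == ord0) = (j == ord_max).
Proof.
rewrite -!val_eqE /=; have := ltn_ord j; rewrite ltnS leq_eqVlt => /orP[/eqP ->|jn].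
  by rewrite modnn !eqxx.
by rewrite modn_small ?ltnS // eqn_leq [in RHS]eqn_leq; lia.
Qed.

Lemma grgt_vert (c f : gcell) : (grgt (c, true) == f) = (c == rightcorner f).
Proof.
apply/eqP/eqP => [<-|->]; rewrite /grgt /rightcorner /=.
  case: c => i j /=; rewrite ord_predK -[ord_pred i == ord_max]ordS_max ord_predK.
  by case: (flip && _); rewrite ?ord_predK ?rev_ordK.
case: f => i j /=; rewrite ordSK ordS_max.
by case: (flip && _); rewrite ?rev_ordK ?ordSK.
Qed.

Lemma grgt_horiz (c f : gcell) : (grgt (c, false) == f) = (c == upc f).
Proof.
apply/eqP/eqP => [<-|->]; rewrite /grgt /upc /=.
  by case: c => i j /=; rewrite ord_predK.
by case: f => i j /=; rewrite ordSK.
Qed.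

Lemma ordS_const (h : I -> bool) : (forall j, h j = h (ordS j)) -> forall j, h j = h ord0.
Proof.
move=> hS j; rewrite -[j]inord_val; elim: (val j) (ltn_ord j) => [|m IH] lt.
  by congr h; apply: val_inj; rewrite /= inordK.
rewrite -(IH (ltnW lt)) [RHS]hS; congr h; apply: val_inj; rewrite /= !inordK ?(ltnW lt) //.
by rewrite modn_small.
Qed.

Lemma grid_const (g : gcell -> bool) :
  (forall c, g c = g (upc c)) ->
  (forall i j, exists j', g (i, j) = g (ordS i, j')) ->
  forall x y, g x = g y.
Proof.
move=> gu gr.
have gj i j : g (i, j) = g (i, ord0).
  by apply: (ordS_const (h := fun j => g (i, j))) => j'; exact: (gu (i, j')).
have gi i : g (i, ord0) = g (ord0, ord0).
  apply: (ordS_const (h := fun i => g (i, ord0))) => i'.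
  by have [j E] := gr i' ord0; rewrite E gj.
by move=> [i j] [i' j']; rewrite gj gi [RHS]gj gi.
Qed.

Lemma grid_complex : closed_complex gsrc gtgt glft grgt.
Proof.
split.
- by rewrite !card_prod card_bool; lia.
- move=> x f.
  rewrite -(pair_bigA _ (fun c b => inc gsrc gtgt (c, b) x * coinc glft grgt (c, b) f)%R) /=.
  rewrite (eq_bigr (fun c => inc gsrc gtgt (c, true) x * (f == c)%:R +
      inc gsrc gtgt (c, true) x * (rightcorner f == c)%:R +
      (inc gsrc gtgt (c, false) x * (f == c)%:R +
      inc gsrc gtgt (c, false) x * (upc f == c)%:R))%R); last first.
    move=> c _; rewrite big_bool /= /coinc grgt_vert grgt_horiz -!mulrDr.
    by rewrite /glft /= ![_ == f]eq_sym ![c == _]eq_sym.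
  rewrite !big_split /= !sumr_delta /inc /gsrc /gtgt /=.
  (* The two cells to the right of a corner, reached in two ways; across the reversed seam they come
     in the opposite order. Each of the four cells around the corner then occurs twice. *)
  have -> : ((rightcorner f == x)%:R + (upc (rightcorner f) == x)%:R
      = (rightc f == x)%:R + (rightc (upc f) == x)%:R :> 'F_2)%R.
    rewrite /rightcorner /rightc /upc /=; case: (flip && _) => //.
    by rewrite ordS_rev addrC.
  move: (f == x)%:R%R (upc f == x)%:R%R (rightc f == x)%:R%R (rightc (upc f) == x)%:R%R.
  move=> a b c d.
  have -> : (a + b + (c + d) + (a + c + (b + d)) = (a + a) + (b + b) + ((c + c) + (d + d)))%R.
    by ring.
  by rewrite !F2_addxx.
- move=> g gE; apply: grid_const.
    by move=> c; exact: (gE (c, true)).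
  by move=> i j; eexists; exact: (gE ((i, j), false)).
- move=> g gE; apply: grid_const.
    move=> c; have := gE (upc c, false); rewrite /glft /grgt /upc /= ordSK => ->.
    by case: c.
  move=> i j; exists (rightcorner (i, j)).2.
  have := gE (rightcorner (i, j), true).
  have /eqP -> : grgt (rightcorner (i, j), true) == (i, j) by rewrite grgt_vert.
  by rewrite /glft /= => ->.
Qed.

End Grid.

(** * From overlapping vertex and edge sets to disjoint branch sets *)

Section Thicken.
Variables (cell side : finType) (src tgt : side -> cell).
Local Notation conn := (conn src tgt).
Local Notation touch := (touch src tgt).

(** [C] is the component of a cell of [B] in [P] minus [D]. If it did not touch [D], it would be
    closed under steps in [P], although [P] is connected and contains a cell of [D]. *)
Lemma branch_extend (B P D : {set cell}) :
  conn B -> conn P -> [disjoint B & D] -> P :&: B != set0 -> P :&: D != set0 ->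
  exists C : {set cell},
    [/\ C \subset P :\: D, conn (B :|: C) & exists e, touch (B :|: C) D e].
Proof.
move=> cB cP dBD /set0Pn[b]; rewrite inE => /andP[bP bB] /set0Pn[d].
rewrite inE => /andP[dP dD].
pose r x y := [&& x \in P :\: D, y \in P :\: D & [exists e, joins src tgt e x y]].
pose C := [set x in P :\: D | connect r b x].
have bD : b \notin D by rewrite (disjointFr dBD bB).
have bC : b \in C by rewrite !inE bP bD connect0.
exists C; split.
- by apply/subsetP => x; rewrite inE => /andP[].
- move=> g gE.
  have gB : {in B &, forall x y, g x = g y}.
    by apply: cB => e sB tB; apply: gE; rewrite inE ?sB ?tB.
  have gC x : x \in C -> g x = g b.
    rewrite [x \in C]inE => /andP[_ /connectP[p]].
    elim/last_ind: p x => [|p y IH] x /=; first by move=> _ ->.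
    rewrite rcons_path last_rcons => /andP[pth lst] ->.
    have pC : last b p \in C.
      rewrite inE; apply/andP; split; first by case/and3P: lst.
      by apply/connectP; exists p.
    have yC : y \in C.
      rewrite inE; apply/andP; split; first by case/and3P: lst.
      by apply/connectP; exists (rcons p y); rewrite ?rcons_path ?pth ?last_rcons.
    rewrite -(IH _ pth erefl).
    case/and3P: lst => _ _ /existsP[e /orP[]/andP[/eqP E1 /eqP E2]].
      by rewrite -E1 -E2; apply/esym; apply: gE; rewrite inE ?E1 ?E2 ?pC ?yC orbT.
    by rewrite -E1 -E2; apply: gE; rewrite inE ?E1 ?E2 ?pC ?yC orbT.
  have gx x : x \in B :|: C -> g x = g b.
    by rewrite inE => /orP[xB|/gC //]; exact: gB.
  by move=> x y /gx -> /gx ->.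
- apply/existsP; apply: contraT; rewrite negb_exists => /forallP nt.
  have step e x y : joins src tgt e x y -> x \in C -> y \in P -> y \in C.
    move=> j xC yP; case: (boolP (y \in D)) => yD.
      have xBC : x \in B :|: C by rewrite in_setU xC orbT.
      have := nt e; rewrite /touch.
      by case/orP: j => /andP[/eqP -> /eqP ->]; rewrite xBC yD ?orbT.
    move: xC; rewrite inE => /andP[xPD cx].
    rewrite inE inE yD yP /=; apply: connect_trans cx _; apply: connect1.
    by apply/and3P; split => //; [rewrite inE yD|apply/existsP; exists e].
  have : (b \in C) = (d \in C).
    apply: (cP (fun x => x \in C)) => // e sP tP.
    have j1 : joins src tgt e (src e) (tgt e) by rewrite /joins !eqxx.
    have j2 : joins src tgt e (tgt e) (src e) by rewrite /joins !eqxx orbT.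
    by apply/idP/idP => h; [exact: step j1 h tP|exact: step j2 h sP].
  by rewrite bC !inE dD.
Qed.

(** [P u v] may overlap [B u] and [B v], so only its part [C] outside the far branch set is used.
    Each edge is absorbed by its end of smaller rank; the branch sets stay disjoint because [P]
    misses all other sets [B] and the sets [P] of other edges. *)
Lemma minor_of_fat (V : finType) (A : {set V * V}) (B : V -> {set cell})
    (P : V -> V -> {set cell}) :
  dsym A -> (forall v, (v, v) \notin A) ->
  (forall v, conn (B v)) -> (forall u v, u != v -> [disjoint B u & B v]) ->
  (forall u v, (u, v) \in A ->
    [/\ conn (P u v), P u v :&: B u != set0 & P u v :&: B v != set0]) ->
  (forall u v w, (u, v) \in A -> w != u -> w != v -> [disjoint P u v & B w]) ->
  (forall u v u' v', (u, v) \in A -> (u', v') \in A ->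
     (u, v) != (u', v') -> (u, v) != (v', u') -> [disjoint P u v & P u' v']) ->
  minor_model src tgt A.
Proof.
move=> sA iA cB dB PP PB dP.
have Anz u v : (u, v) \in A -> u != v by move=> uv; apply: contraTneq uv => ->.
have [C CP] : exists C : V * V -> {set cell}, forall p, p \in A ->
    [/\ C p \subset P p.1 p.2 :\: B p.2, conn (B p.1 :|: C p) &
        exists e, touch (B p.1 :|: C p) (B p.2) e].
  apply: (fin_all_exists (T := (V * V)%type) (P := fun p (Cp : {set cell}) => p \in A ->
    [/\ Cp \subset P p.1 p.2 :\: B p.2, conn (B p.1 :|: Cp) &
        exists e, touch (B p.1 :|: Cp) (B p.2) e])) => -[u v].
  case: (boolP ((u, v) \in A)) => uv; last by exists set0.
  have [cP Pu Pv] := PP _ _ uv.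
  by have [D DP] := branch_extend (cB u) cP (dB _ _ (Anz _ _ uv)) Pu Pv; exists D.
pose lt (u v : V) := enum_rank u < enum_rank v.
pose B' v := B v :|: \bigcup_(u | ((v, u) \in A) && lt v u) C (v, u).
have BB v : B v \subset B' v by exact: subsetUl.
have BC u v : (u, v) \in A -> lt u v -> B u :|: C (u, v) \subset B' u.
  by move=> uv l; apply: setUS; apply: (bigcup_max v) => //; rewrite uv l.
have B'P v x : x \in B' v -> x \in B v \/
    exists u, [/\ (v, u) \in A, lt v u & x \in C (v, u)].
  rewrite inE => /orP[|/bigcupP[u /andP[vu l] xC]]; [by left|right].
  by exists u.
have CPB u v x : (u, v) \in A -> x \in C (u, v) -> (x \in P u v) && (x \notin B v).
  by move=> uv xC; have [/subsetP/(_ _ xC) + _ _] := CP _ uv; rewrite inE andbC.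
have nBC v w x : v != w -> x \in B w -> x \in B' v -> False.
  move=> vw xw /B'P[xv|[u [vu _ /(CPB _ _ _ vu)/andP[xP xu]]]].
    by have := disjointFr (dB _ _ vw) xv; rewrite xw.
  have wu : w != u by apply: contraNneq xu => <-.
  have := disjointFr (PB _ _ w vu _ wu) xP.
  by rewrite eq_sym vw xw => /(_ isT).
exists B'; split.
- move=> v w vw; apply/pred0P => x /=; apply: negbTE; apply/negP => /andP[xv xw].
  case/B'P: (xv) => [xB|[u [vu l1 xC]]].
    by apply: (nBC w v x) => //; rewrite eq_sym.
  case/B'P: (xw) => [xB|[y [wy l2 xD]]]; first exact: (nBC v w x).
  have /andP[xP _] := CPB _ _ _ vu xC.
  have /andP[xP' _] := CPB _ _ _ wy xD.
  have n1 : (v, u) != (w, y) by rewrite xpair_eqE negb_and vw.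
  have n2 : (v, u) != (y, w).
    apply/negP => /eqP[E1 E2]; move: l1 l2; rewrite /lt E1 E2 => a b.
    by have := ltn_trans a b; rewrite ltnn.
  by have := disjointFr (dP _ _ _ _ vu wy n1 n2) xP; rewrite xP'.
- move=> v g gE.
  have gB : {in B v &, forall x y, g x = g y}.
    by apply: cB => e s t; apply: gE; apply: (subsetP (BB v)).
  have near x : x \in B' v -> exists2 b, b \in B v & g x = g b.
    case/B'P => [xB|[u [vu l xC]]]; first by exists x.
    have [_ /set0Pn[b]] := PP _ _ vu; rewrite inE => /andP[_ bB] _; exists b => //.
    have [_ cC _] := CP _ vu.
    apply: cC; last 2 first.
    + by rewrite inE xC orbT.
    + by rewrite inE bB.
    by move=> e s t; apply: gE; apply: (subsetP (BC _ _ vu l)).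
  by move=> x y /near[b bB ->] /near[b' bB' ->]; exact: gB.
- have tl u v : (u, v) \in A -> lt u v -> exists e, touch (B' u) (B' v) e.
    move=> uv l; have [_ _ [e te]] := CP _ uv; exists e.
    by apply: touch_mono te; [exact: BC|exact: BB].
  move=> u v uv; case: (ltnP (enum_rank u) (enum_rank v)) => [l|]; first exact: tl.
  rewrite leq_eqVlt => /orP[/eqP/val_inj/enum_rank_inj E|l].
    by move: (Anz _ _ uv); rewrite E eqxx.
  rewrite sA in uv; have [e te] := tl _ _ uv l.
  by exists e; rewrite touchC.
Qed.

End Thicken.

(** * Unit squares of the plane modulo the deck group *)

Section Residues.
Variables (n : nat) (flip : bool).
Local Open Scope ring_scope.
Local Notation N := (n.+1%:Z).

Definition twist (m : int) : bool := flip && odd `|m|%N.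
(** Reflection maps the interval from [l] to [l + 1] to the one starting at [-1 - l]. *)
Definition turn (m l : int) : int := if twist m then -1 - l else l.

Definition residue (k : int) : 'I_n.+1 := inord `|(k %% N)%Z|%N.

(* The cell of the quotient containing the square with lower left vertex
   (k / n.+1, l / n.+1): passing from one vertical strip of width 1 to the next
   reverses the second coordinate if [flip]. *)
Definition cell_of (k l : int) : gcell n :=
  (residue k, residue (turn (k %/ N)%Z l)).

Lemma twistD m m' : twist (m + m') = twist m (+) twist m'.
Proof. by rewrite /twist; case: flip => //=; lia. Qed.

Lemma residueE (q : int) (r : 'I_n.+1) : residue (q * N + r%:Z) = r.
Proof.
rewrite /residue modzMDl modz_small /=; first by apply: val_inj; rewrite /= inordK.
by have := ltn_ord r; lia.
Qed.

Lemma divzE (q : int) (r : 'I_n.+1) : ((q * N + r%:Z) %/ N)%Z = q.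
Proof.
rewrite divzMDl // divz_small ?addr0 //.
by have := ltn_ord r; lia.
Qed.

Lemma int_split (k : int) : k = (k %/ N)%Z * N + (residue k)%:Z.
Proof.
have m0 : 0 <= (k %% N)%Z by apply: modz_ge0.
have mN : (k %% N)%Z < N by apply: ltz_pmod.
rewrite {1}(divz_eq k N) /residue inordK; first by rewrite gez0_abs.
by lia.
Qed.

Lemma residueD (k j : int) : residue (k + j * N) = residue k.
Proof.
by rewrite {1}(int_split k) addrAC -mulrDl residueE.
Qed.

Lemma residueS k : residue (k + 1) = ordS (residue k).
Proof.
rewrite {1}(int_split k); set r := residue k; set q := (k %/ N)%Z.
have := ltn_ord r; rewrite ltnS leq_eqVlt => /orP[/eqP rn|rn].
  have -> : q * N + r%:Z + 1 = (q + 1) * N + (ord0 : 'I_n.+1)%:Z.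
    by rewrite rn /=; lia.
  by rewrite residueE; apply: val_inj; rewrite /= rn modnn.
have rS : (r.+1 < n.+1)%N by rewrite ltnS.
have -> : q * N + r%:Z + 1 = q * N + (Ordinal rS)%:Z by rewrite /=; lia.
by rewrite residueE; apply: val_inj; rewrite /= modn_small.
Qed.

Lemma residueN k : residue (-1 - k) = rev_ord (residue k).
Proof.
rewrite {1}(int_split k); set r := residue k; set q := (k %/ N)%Z.
have -> : -1 - (q * N + r%:Z) = (- q - 1) * N + (rev_ord r)%:Z.
  rewrite /=; have := ltn_ord r; rewrite mulrBl mul1r mulNr subSS => rn.
  have -> : (n - r)%N%:Z = n%:Z - r%:Z by lia.
  lia.
by rewrite residueE.
Qed.

Lemma residue_eq k k' : residue k = residue k' -> exists j, k' = k + j * N.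
Proof.
move=> E; exists ((k' %/ N)%Z - (k %/ N)%Z).
have := int_split k'; have := int_split k; rewrite -E {E}.
by move: (k %/ N)%Z (k' %/ N)%Z (residue k) => q q' r -> ->; ring.
Qed.

Lemma turn_mod m l j : residue (turn m (l + j * N)) = residue (turn m l).
Proof.
rewrite /turn; case: (twist m); last exact: residueD.
by rewrite opprD addrA -mulNr residueD.
Qed.

Lemma turnK m m' l : turn m (turn m' l) = turn (m + m') l.
Proof.
by rewrite /turn twistD; case: (twist m); case: (twist m') => //=; lia.
Qed.

Lemma divzS (k j : int) : ((k + j * N) %/ N)%Z = (k %/ N)%Z + j.
Proof. by rewrite divzDr ?dvdz_mull // mulzK. Qed.

Lemma cell_of_act m j k l : cell_of (k + m * N) (turn m l + j * N) = cell_of k l.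
Proof.
rewrite /cell_of residueD divzS turn_mod turnK; congr (_, residue _).
by rewrite /turn !twistD -addbA addbb addbF.
Qed.

(** The fibres of [cell_of] are single orbits of squares. Equality of the columns determines [m];
    applying [turn (q + m)], which is an involution, then solves for [l']. *)
Lemma cell_of_eq k l k' l' : cell_of k l = cell_of k' l' ->
  exists m j, k' = k + m * N /\ l' = turn m l + j * N.
Proof.
case=> /residue_eq[m ->]; rewrite divzS.
move: (k %/ N)%Z => q /residue_eq[j E]; exists m.
have : turn (q + m) (turn (q + m) l') = turn (q + m) (turn q l + j * N) by rewrite -E.
rewrite turnK {1}/turn twistD addbb => ->.
rewrite /turn twistD; case: (twist q); case: (twist m) => /=;
  [exists j|exists (- j)|exists (- j)|exists j]; split => //; lia.
Qed.

Lemma cell_of_right k l : rightc flip (cell_of k l) = cell_of (k + 1) l.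
Proof.
rewrite /rightc /cell_of /= residueS; congr (_, _).
rewrite -ordS_max -residueS.
set r := residue (k + 1).
have kE := int_split (k + 1); rewrite -/r in kE.
move: kE; move: ((k + 1) %/ N)%Z => q kE.
case: (boolP (r == ord0)) => [/eqP r0|r0].
  have kq : k = (q - 1) * N + (ord_max : 'I_n.+1)%:Z.
    by move: kE; rewrite r0 /=; lia.
  have -> : (k %/ N)%Z = q - 1 by rewrite kq divzE.
  have -> : turn q l = turn (q - 1 + 1) l by rewrite subrK.
  move: (q - 1) => q'; rewrite andbT /turn twistD /twist; case: flip => //=.
  by case: (odd _) => /=; rewrite ?residueN ?rev_ordK.
rewrite andbF; congr (residue (turn _ l)).
have r1 : (r.-1 < n.+1)%N by have := ltn_ord r; lia.
have kq : k = q * N + (Ordinal r1)%:Z.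
  have : (0 < r)%N by rewrite lt0n; apply: contra r0 => /eqP h; apply/eqP/val_inj.
  by move: kE; rewrite /=; lia.
by rewrite kq divzE.
Qed.

(** In a reversed strip, going up in the plane is going down in the quotient. *)
Lemma cell_of_up k l : cell_of k (l + 1) = upc (cell_of k l) \/
  cell_of k l = upc (cell_of k (l + 1)).
Proof.
rewrite /cell_of /upc /= /turn; case: (twist _); [right|left]; congr (_, _).
  by rewrite -residueS; congr residue; lia.
exact: residueS.
Qed.

End Residues.

From mathcomp Require Import all_classical all_reals topology normedtype.
Import numFieldNormedType.Exports.

(** * Discretizing an embedding *)

Section IntGap.
Local Open Scope ring_scope.

Lemma int_gap (K : realType) (a : K) :
  exists2 e : K, 0 < e & forall z : int, a = z%:~R \/ e <= `|a - z%:~R|.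
Proof.
have fl := floor_le a; have fu := floorD1_gt a.
set f := Num.floor a in fl fu.
case: (eqVneq a f%:~R) => [aE|aN].
  exists 1 => // z; case: (eqVneq f z) => [<-|fz]; [by left|right].
  rewrite aE -intrB -intr_norm ler1z; lia.
exists (Num.min (a - f%:~R) (f%:~R + 1 - a)).
  by rewrite lt_min !subr_gt0 lt_neqAle eq_sym aN fl /=; move: fu; rewrite intrD.
move=> z; right; rewrite ge_min; case: (leP z f) => zf; apply/orP.
  left; apply: le_trans (ler_norm _); rewrite lerB // ler_int; lia.
right; rewrite distrC; apply: le_trans (ler_norm _); rewrite lerB // -intrD1 ler_int; lia.
Qed.

End IntGap.

Section Surface.
Local Open Scope classical_set_scope.
Local Open Scope ring_scope.

Variables (K : realType) (flip : bool) (X : topologicalType) (pi : K * K -> X).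

(* With [flip = false] these are the translations defining the torus, with
   [flip = true] the maps defining the Klein bottle. *)
Definition act (m j : int) (p : K * K) : K * K :=
  (p.1 + m%:~R, (-1) ^+ twist flip m * p.2 + j%:~R).

(** The interface through which both surfaces are treated at once: a quotient map whose fibres are
    the orbits of the deck group. *)
Definition surface_quotient :=
  [/\ forall x, exists p, pi p = x,
      continuous pi,
      forall U : set X, open (pi @^-1` U) -> open U &
      forall p q, pi p = pi q <-> exists m j, q = act m j p].

Hypothesis pi_quot : surface_quotient.

Let pi_eq p q : pi p = pi q <-> exists m j, q = act m j p.
Proof. by case: pi_quot. Qed.

Let pi_surj x : exists p, pi p = x.
Proof. by case: pi_quot. Qed.

Section Cells.
Variable n : nat.
Local Notation N := (n.+1%:R : K).
Local Notation cell_of := (cell_of n flip).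

Definition square (k l : int) (p : K * K) :=
  [/\ k%:~R <= N * p.1, N * p.1 <= (k + 1)%:~R,
      l%:~R <= N * p.2 & N * p.2 <= (l + 1)%:~R].

Lemma square_act m j k l p : square k l p ->
  square (k + m * n.+1%:Z) (turn flip m l + j * n.+1%:Z) (act m j p).
Proof.
have cast (i z : int) : (i + z * n.+1%:Z)%:~R = i%:~R + z%:~R * N :> K.
  by rewrite intrD intrM -pmulrn.
case=> h1 h2 h3 h4; rewrite /square /act /=.
rewrite ![_ + _ * _ + 1]addrAC !cast.
split; rewrite ?mulrDr; [lra|lra| |].
all: rewrite /turn; case: (twist flip m); rewrite ?expr1 ?expr0 ?mulN1r ?mul1r.
- rewrite intrB; lra.
- lra.
- have -> : -1 - l + 1 = - l by lia.
  by rewrite intrN; lra.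
- lra.
Qed.

Definition cellset (c : gcell n) : set X :=
  [set x | exists k l p, [/\ cell_of k l = c, square k l p & pi p = x]].

Lemma cell_cover x : exists c, cellset c x.
Proof.
have [p px] := pi_surj x.
exists (cell_of (Num.floor (N * p.1)) (Num.floor (N * p.2))).
exists (Num.floor (N * p.1)), (Num.floor (N * p.2)), p; split => //.
by split; rewrite ?floor_le // ltW // floorD1_gt.
Qed.

Lemma cell_rep c x p : cellset c x -> pi p = x ->
  exists k l, cell_of k l = c /\ square k l p.
Proof.
case=> k [l [q [kl sq qx]]] px.
have /pi_eq[m [j ->]] : pi q = pi p by rewrite qx px.
eexists; eexists; split; last exact: square_act sq.
by rewrite cell_of_act.
Qed.

(** All cells containing [x] lift to squares containing one fixed point [p] above it. Their indices
    differ by at most 1 in each coordinate, and the square [(k', l)], which also contains [p], links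
    the two. *)
Lemma cell_conn x (g : gcell n -> bool) :
  (forall e : gside n, cellset (gsrc e) x -> cellset (gtgt flip e) x ->
     g (gsrc e) = g (gtgt flip e)) ->
  forall c c', cellset c x -> cellset c' x -> g c = g c'.
Proof.
move=> gE c c' cx c'x; have [p px] := pi_surj x.
have [k [l [<- sq]]] := cell_rep cx px.
have [k' [l' [<- sq']]] := cell_rep c'x px.
have cs i j : square i j p -> cellset (cell_of i j) x by exists i, j, p.
have gh i j : square i j p -> square (i + 1) j p ->
    g (cell_of i j) = g (cell_of (i + 1) j).
  move=> s1 s2; have := gE (cell_of i j, false).
  by rewrite /gsrc /gtgt /= cell_of_right; apply; exact: cs.
have gv i j : square i j p -> square i (j + 1) p ->
    g (cell_of i j) = g (cell_of i (j + 1)).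
  move=> s1 s2; have [E|E] := cell_of_up n flip i j.
    by have := gE (cell_of i j, true); rewrite /gsrc /gtgt /= -E; apply; exact: cs.
  by have := gE (cell_of i (j + 1), true); rewrite /gsrc /gtgt /= -E => ->; try exact: cs.
have near1 (z z' : int) (a : K) : z%:~R <= a -> a <= (z + 1)%:~R ->
    z'%:~R <= a -> a <= (z' + 1)%:~R -> [\/ z' = z, z' = z + 1 | z = z' + 1].
  move=> h1 h2 h3 h4.
  have : (z <= z' + 1) && (z' <= z + 1).
    by rewrite -!(ler_int K) (le_trans h1 h4) (le_trans h3 h2).
  case: (ltgtP z z') => zz h; [constructor 2|constructor 3|constructor 1]; lia.
case: sq sq' => a1 a2 a3 a4 [b1 b2 b3 b4].
have mid : square k' l p by split.
transitivity (g (cell_of k' l)).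
  case: (near1 _ _ _ a1 a2 b1 b2) => E; first by rewrite E.
    by rewrite E; apply: gh; [split|rewrite -E].
  by rewrite E; apply/esym; apply: gh; [|rewrite -E; split].
case: (near1 _ _ _ a3 a4 b3 b4) => E; first by rewrite E.
  by rewrite E; apply: gv; [|rewrite -E; split].
by rewrite E; apply/esym; apply: gv; [split|rewrite -E].
Qed.

Lemma cell_close c p q : cellset c (pi p) -> cellset c (pi q) -> exists m j,
  `|p.1 - (act m j q).1| <= N^-1 /\ `|p.2 - (act m j q).2| <= N^-1.
Proof.
move=> /cell_rep /(_ erefl)[k [l [kl sp]]] /cell_rep /(_ erefl)[k' [l' [kl' sq]]].
have [|m [j [kE lE]]] := @cell_of_eq n flip k' l' k l; first by rewrite kl kl'.
exists m, j; have := square_act m j sq; rewrite -kE -lE.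
move: (act m j q) => r [b1 b2 b3 b4]; case: sp => a1 a2 a3 a4.
rewrite !intrD in a2 a4 b2 b4.
have N0 : 0 < N by rewrite ltr0n.
have aux (a b : K) : `|N * a - N * b| <= 1 -> `|a - b| <= N^-1.
  by rewrite -mulrBr normrM gtr0_norm // -ler_pdivlMl // mulr1.
by split; apply: aux; rewrite ler_norml; apply/andP; split; lra.
Qed.

End Cells.

(** A point of the orbit of [q] has second coordinate [q.2 + j] or [- q.2 + j], so the distances of
    [p.1 - q.1], [p.2 - q.2] and [p.2 + q.2] from the other integers bound the gap. *)
Lemma orbit_gap p q : pi p <> pi q -> exists2 e : K, 0 < e &
  forall m j, e <= `|p.1 - (act m j q).1| \/ e <= `|p.2 - (act m j q).2|.
Proof.
move=> pq.
have [e1 e10 h1] := int_gap (p.1 - q.1).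
have [e2 e20 h2] := int_gap (p.2 - q.2).
have [e3 e30 h3] := int_gap (p.2 + q.2).
exists (Num.min e1 (Num.min e2 e3)); first by rewrite !lt_min e10 e20 e30.
move=> m j; rewrite /act /= !opprD !addrA.
have [E1|l1] := h1 m; last by left; rewrite ge_min l1.
right; rewrite !ge_min.
have nE y : y = (-1) ^+ twist flip m * q.2 -> p.2 - y <> j%:~R.
  move=> -> E2; apply: pq; apply/esym/pi_eq; exists m, j.
  rewrite /act [LHS]surjective_pairing; congr (_, _).
    by rewrite -E1 addrC subrK.
  by rewrite -E2 addrC subrK.
move: nE; case: (twist flip m); rewrite ?expr1 ?expr0 ?mulN1r ?mul1r => nE.
  rewrite opprK; have [E|l] := h3 j; last by rewrite l !orbT.
  by case: (nE _ erefl); rewrite opprK.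
by have [E|l] := h2 j; [case: (nE _ erefl)|rewrite l orbT].
Qed.

Definition box (p : K * K) (d : K) : set (K * K) :=
  [set q | `|q.1 - p.1| < d /\ `|q.2 - p.2| < d].

Lemma act_dist1 m j p q : `|(act m j p).1 - (act m j q).1| = `|p.1 - q.1|.
Proof. by rewrite /act /= opprD addrACA subrr addr0. Qed.

Lemma act_dist2 m j p q : `|(act m j p).2 - (act m j q).2| = `|p.2 - q.2|.
Proof.
by rewrite /act /= opprD addrACA subrr addr0 -mulrBr normrM normrX normrN1 expr1n mul1r.
Qed.

(** The preimage of the image is a union of translates of the box under maps that preserve
    coordinate distances, hence open. *)
Lemma nbhs_box p d : 0 < d -> nbhs (pi p) (pi @` box p d).
Proof.
move=> d0.
have op : open (pi @` box p d).
  have [_ _ pi_open _] := pi_quot; apply: pi_open.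
  rewrite openE => q /= [q0 [h1 h2] /esym/pi_eq[m [j q0E]]].
  apply/nbhs_ballP.
  exists (Num.min (d - `|q0.1 - p.1|) (d - `|q0.2 - p.2|)) => /=.
    by rewrite lt_min !subr_gt0 h1 h2.
  move=> r [b1 b2]; exists (act m j r); last by apply/esym/pi_eq; exists m, j.
  have tri (a b c : K) : `|a - c| <= `|b - a| + `|b - c|.
    by rewrite (distrC b a); apply: le_trans (ler_normD _ _); rewrite addrA subrK.
  move: b1 b2; rewrite -!ball_normE /= !lt_min => /andP[b1 _] /andP[_ b2].
  split.
    apply: le_lt_trans (tri _ (act m j q).1 _) _.
    by rewrite act_dist1 -q0E; lra.
  apply: le_lt_trans (tri _ (act m j q).2 _) _.
  by rewrite act_dist2 -q0E; lra.
apply: open_nbhs_nbhs; split => //.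
by exists p => //; split; rewrite subrr normr0.
Qed.

(** Points of a common cell have lifts within [1 / n.+1] of each other, so with boxes of radius
    [e / 4] a cell meeting both would bring the orbits closer than [3 e / 4]. *)
Lemma cell_sep (x y : X) : x <> y -> exists U V : set X, [/\ nbhs x U, nbhs y V &
  exists n0, forall n, (n0 <= n)%N -> forall (c : gcell n) x' y',
    U x' -> V y' -> cellset c x' -> cellset c y' -> False].
Proof.
have [p <-] := pi_surj x; have [q <-] := pi_surj y => /orbit_gap[e e0 gap].
have e4 : 0 < e / 4 by lra.
exists (pi @` box p (e / 4)), (pi @` box q (e / 4)); split; try exact: nbhs_box.
(* This makes [n.+1] exceed [4 / e]. *)
exists (Num.trunc (4 / e)) => n nn c _ _ [p' [p1 p2] <-] [q' [q1 q2] <-] cp cq.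
have [m [j [c1 c2]]] := cell_close cp cq.
have N4 : n.+1%:R^-1 < e / 4 :> K.
  rewrite -[e / 4]invrK ltf_pV2 ?posrE ?invr_gt0 // ?ltr0n // invf_div.
  apply: lt_le_trans (truncnS_gt _) _.
  by rewrite ler_nat.
have d1 := act_dist1 m j q' q; have d2 := act_dist2 m j q' q.
have key (a b a' b' : K) : `|a' - b'| <= n.+1%:R^-1 -> `|a' - a| < e / 4 ->
    `|b' - b| < e / 4 -> `|a - b| < e.
  move=> /le_lt_trans/(_ N4) h1 h2 h3.
  have -> : a - b = (a' - b') - (a' - a) + (b' - b) by ring.
  apply: le_lt_trans (ler_normD _ _) _.
  apply: le_lt_trans (lerD (ler_normB _ _) (lexx _)) _; lra.
case: (gap m j) => g.
  by have := key _ (act m j q).1 _ _ c1 p1; rewrite d1 => /(_ q1); rewrite ltNge g.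
by have := key _ (act m j q).2 _ _ c2 p2; rewrite d2 => /(_ q2); rewrite ltNge g.
Qed.

(** A point common to both neighbourhoods would lie in some cell meeting both. *)
Lemma surface_hausdorff : hausdorff_space X.
Proof.
move=> x y cl; apply: contrapT => /cell_sep[U [V [Ux Vy [n0 sep]]]].
have [z [Uz Vz]] := cl _ _ Ux Vy.
have [c cz] := @cell_cover n0 z.
exact: (sep n0 (leqnn _) c z z).
Qed.

(** Any square above [c] can be moved to the one with indices [(c.1, c.2)], so the cell is the image
    of a single compact square. *)
Lemma cell_closed n (c : gcell n) : closed (cellset c).
Proof.
have [_ pi_cont _ _] := pi_quot.
apply: compact_closed; first exact: surface_hausdorff.
have cc : cell_of n flip (c.1 : nat) (c.2 : nat) = c.
  have h (i : 'I_n.+1) : Posz i = 0 * n.+1%:Z + i%:Z by rewrite mul0r add0r.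
  by rewrite /cell_of h divzE residueE /turn /twist andbF h residueE -surjective_pairing.
have -> : cellset c = pi @` [set p | square n c.1 c.2 p].
  apply/seteqP; split => [x|_ [p sq <-]].
    case=> k [l [p [kl sq <-]]].
    have [|m [j [E1 E2]]] := @cell_of_eq n flip k l (c.1 : nat) (c.2 : nat).
      by rewrite kl cc.
    exists (act m j p); first by rewrite /= E1 E2; exact: square_act.
    by apply/esym/pi_eq; exists m, j.
  by exists c.1, c.2, p; split.
apply: continuous_compact; first by apply: continuous_subspaceT.
have N0 : 0 < n.+1%:R :> K by rewrite ltr0n.
pose J (i : int) : set K := `[i%:~R / n.+1%:R, (i + 1)%:~R / n.+1%:R]%classic.
have JE i (a : K) : J i a <-> i%:~R <= n.+1%:R * a /\ n.+1%:R * a <= (i + 1)%:~R.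
  rewrite /J /= in_itv /= ler_pdivrMr // ler_pdivlMr // mulrC.
  by split => [/andP[]|[-> ->]].
have -> : [set p | square n c.1 c.2 p] = J c.1 `*` J c.2.
  apply/seteqP; split => [p [h1 h2 h3 h4]|p [/JE[h1 h2] /JE[h3 h4]]] /=.
    by split; apply/JE.
  by split.
by apply: compact_setX; exact: segment_compact.
Qed.

End Surface.

(** * Cells met by arcs *)

Section Arcs.
Local Open Scope classical_set_scope.
Local Open Scope ring_scope.
Variables (K : realType) (flip : bool) (X : topologicalType) (pi : K * K -> X).
Hypothesis pi_quot : surface_quotient flip pi.

Local Notation cellset := (cellset flip pi).

Definition hits n (g : K -> X) (a b : K) : {set gcell n} :=
  [set c | `[< exists2 t, a <= t <= b & cellset c (g t) >]]%SET.

Lemma hitsP n g a b (c : gcell n) :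
  reflect (exists2 t, a <= t <= b & cellset c (g t)) (c \in hits n g a b).
Proof. by rewrite inE; exact: asboolP. Qed.

Lemma arc_nbhs (g : K -> X) t (U : set X) : {within `[0, 1], continuous g} ->
  0 <= t <= 1 -> nbhs (g t) U -> nbhs t [set s | 0 <= s <= 1 -> U (g s)].
Proof.
move=> /subspace_continuousP gc t01 Ut.
have At : `[0, 1]%classic t by rewrite /= in_itv.
have : nbhs t (fun s => `[0, 1]%classic s -> U (g s)) by exact: gc At _ Ut.
by apply: filterS => s hs s01; apply: hs; rewrite /= in_itv.
Qed.

(** The grid size required by [cell_sep] depends on the two points; compactness of the product of
    the parameter intervals makes it uniform. *)
Lemma hits_sep (g g' : K -> X) (a b a' b' : K) :
  {within `[0, 1], continuous g} -> {within `[0, 1], continuous g'} ->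
  0 <= a -> b <= 1 -> 0 <= a' -> b' <= 1 ->
  (forall t t', a <= t <= b -> a' <= t' <= b' -> g t <> g' t') ->
  \forall n \near \oo, [disjoint hits n g a b & hits n g' a' b']%B.
Proof.
move=> gc gc' a0 b1 a0' b1' dj.
have cK : compact (`[a, b]%classic `*` `[a', b']%classic : set (K * K)).
  by apply: compact_setX; exact: segment_compact.
move/compact_near_coveringP: cK => cK.
pose P (n : nat) (p : K * K) := a <= p.1 <= b -> a' <= p.2 <= b' ->
  forall c : gcell n, cellset c (g p.1) -> cellset c (g' p.2) -> False.
have in01 (s t x : K) : 0 <= s -> t <= 1 -> s <= x <= t -> 0 <= x <= 1.
  by move=> s0 t1 /andP[sx xt]; rewrite (le_trans s0 sx) (le_trans xt t1).
have /(cK nat \oo P _) : forall p, (`[a, b]%classic `*` `[a', b']%classic) p ->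
    \forall p' \near p & i \near \oo, P i p'.
  move=> [t t'] [/= t1 t2]; rewrite in_itv /= in t1; rewrite in_itv /= in t2.
  have [U [V [Ut Vt [n0 sep]]]] := cell_sep pi_quot (dj _ _ t1 t2).
  exists ([set s | 0 <= s <= 1 -> U (g s)] `*` [set s | 0 <= s <= 1 -> V (g' s)],
          [set n | (n0 <= n)%N]) => /=.
    split; last exact: nbhs_infty_ge.
    exists ([set s | 0 <= s <= 1 -> U (g s)], [set s | 0 <= s <= 1 -> V (g' s)]) => //=.
    by split; apply: arc_nbhs => //; [exact: in01 t1|exact: in01 t2].
  move=> [[s s'] n] /= [[sU sV] nn] s1 s2 c cs cs'.
  apply: (sep n nn c _ _ _ _ cs cs'); first by apply: sU; exact: in01 s1.
  by apply: sV; exact: in01 s2.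
apply: filterS => n Pn; apply/pred0P => c /=; apply: negbTE; apply/negP.
move=> /andP[/hitsP[t tab ct] /hitsP[t' tab' ct']].
by apply: (Pn (t, t')) ct ct' => //=; split; rewrite /= in_itv.
Qed.

(** For a locally constant [h], the parameters at which some cell of value [v] is met form a closed
    set [D v]. The two sets cover the segment and are disjoint by [cell_conn], so connectedness of
    the segment leaves one of them. *)
Lemma hits_conn n (g : K -> X) (a b : K) : {within `[0, 1], continuous g} ->
  0 <= a -> b <= 1 -> conn (@gsrc n) (@gtgt n flip) (hits n g a b).
Proof.
move=> gc a0 b1 h hE.
have in01 x : a <= x <= b -> 0 <= x <= 1.
  by move=> /andP[ax xb]; rewrite (le_trans a0 ax) (le_trans xb b1).
pose D (v : bool) := [set t | a <= t <= b /\ exists2 c, h c = v & cellset (n := n) c (g t)].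
have same t c c' : a <= t <= b -> cellset (n := n) c (g t) -> cellset c' (g t) -> h c = h c'.
  move=> tab; apply: (cell_conn pi_quot) => e cs ct; apply: hE; apply/hitsP; by exists t.
have clD v : closed (D v).
  move=> t clt.
  have tab : a <= t <= b.
    have : closed `[a, b]%classic by exact: itv_closed.
    move/(_ t); rewrite /= in_itv /=; apply => U /clt[s [[sab _] Us]].
    by exists s; split => //; rewrite /= in_itv.
  split => //; apply: contrapT => no.
  have : \forall x \near nbhs (g t), forall c : gcell n, h c = v -> ~ cellset c x.
    apply: filter_forall => c.
    have [hc|hc] := pselect (h c = v); last by apply: nearW => x /hc.
    have : nbhs (g t) (~` cellset c).
      apply: open_nbhs_nbhs; split; first by apply: closed_openC; exact: (cell_closed pi_quot).
      by move=> ct; apply: no; exists c.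
    by apply: filterS => x ? _.
  move/(arc_nbhs gc (in01 _ tab))/clt => [s [[sab [c hc cs]] /=]].
  by move/(_ (in01 _ sab) c hc).
have all_v t0 c0 v : a <= t0 <= b -> cellset (n := n) c0 (g t0) -> h c0 = v ->
    forall t, a <= t <= b -> D v t.
  move=> t0ab c0t hv.
  have : D v = `[a, b]%classic.
    apply: (@segment_connected K a b).
    - by exists t0; split => //; exists c0.
    - exists (~` D (~~ v)); first by rewrite openC; exact: clD.
      apply/seteqP; split => t /=; rewrite in_itv /=.
        move=> [tab [c hc ct]]; split => // -[_ [c' hc' ct']].
        by have := same _ _ _ tab ct ct'; rewrite hc hc'; case: (v).
      move=> [tab nD]; split => //.
      have [c ct] := @cell_cover _ _ _ _ pi_quot n (g t); exists c => //.
      apply: contrapT => hc; apply: nD; split => //; exists c => //.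
      by case: (h c) (v) hc => -[].
    - exists (D v); first exact: clD.
      apply/seteqP; split => t /=; last by case.
      by rewrite in_itv /= => h'; split => //; case: h'.
  by move=> E t tab; rewrite E /= in_itv.
move=> c c' /hitsP[t tab ct] /hitsP[t' tab' ct'].
have [_ [c1 h1 ct1]] := all_v _ _ _ tab ct erefl _ tab'.
by rewrite -h1; exact: same ct1 ct'.
Qed.

End Arcs.

Section Embedding.
Local Open Scope classical_set_scope.
Local Open Scope ring_scope.
Variables (K : realType) (flip : bool) (X : topologicalType) (pi : K * K -> X).
Hypothesis pi_quot : surface_quotient flip pi.
Variable G : sgraph.

(** [B] collects the cells met by the initial thirds of the arcs leaving a vertex, [P] those met by
    the middle third of an arc. There are finitely many pairs of arcs, so one grid is fine enough
    for all separations. *)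
Lemma embedding_minor : embeddable K G X ->
  exists n, minor_model (@gsrc n) (@gtgt n flip) (darts G).
Proof.
case=> pt [arc [pt_inj arcP arc_pt arc_arc]].
have arcc u v : adj u v -> {within `[0, 1], continuous (arc u v)} by case/arcP.
have arc0 u v : adj u v -> arc u v 0 = pt u by case/arcP => _ _ [].
have arcV u v t : adj u v -> 0 <= t <= 1 -> arc v u t = arc u v (1 - t).
  by case/arcP => _ _ _ + t01; apply; rewrite in_itv.
(* Arcs without their final point meet only if they start at the same vertex or run oppositely along
   one edge; then [t = 1 - t'], which is impossible within initial thirds. *)
have meet u v u' v' t t' : adj u v -> adj u' v' -> 0 <= t < 1 -> 0 <= t' < 1 ->
    arc u v t = arc u' v' t' -> u = u' \/ [/\ u' = v, v' = u & t = 1 - t'].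
  move=> uv uv'; rewrite !le_eqVlt => /andP[+ t1] /andP[+ t1'].
  move=> /orP[/eqP <-|t0] /orP[/eqP <-|t0'].
  - by rewrite !arc0 // => /pt_inj; left.
  - by rewrite arc0 // => /esym /(arc_pt _ _ _ _ uv'); rewrite in_itv /= t0' t1' => /(_ isT).
  - by rewrite (arc0 u') // => /(arc_pt _ _ _ _ uv); rewrite in_itv /= t0 t1 => /(_ isT).
  move=> E; have := arc_arc _ _ _ _ _ _ uv uv' _ _ E; rewrite !in_itv /= t0 t1 t0' t1'.
  move=> /(_ isT isT) /set2_inj[[]|[uE vE]]; [by left|right; split => //].
  have [_ inj _ _] := arcP _ _ uv.
  apply: inj; rewrite ?in_itv /= ?(ltW t0) ?(ltW t1) //; first by apply/andP; split; lra.
  by rewrite E -uE -vE; apply: arcV => //; rewrite (ltW t0') (ltW t1').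
pose B n v := (\bigcup_(u | adj v u) hits flip pi n (arc v u) 0 (1 / 3))%SET.
pose P n u v := hits flip pi n (arc u v) (1 / 3) (2 / 3).
have sep1 : \forall n \near \oo, forall p : (G * G) * (G * G),
    adj p.1.1 p.1.2 -> adj p.2.1 p.2.2 -> p.1.1 != p.2.1 ->
    [disjoint hits flip pi n (arc p.1.1 p.1.2) 0 (1 / 3) &
              hits flip pi n (arc p.2.1 p.2.2) 0 (1 / 3)]%B.
  apply: filter_forall => -[[u v] [u' v']] /=.
  have [/andP[/andP[uv uv'] uu]|no] := pselect ([&& adj u v && adj u' v' & u != u']); last first.
    by apply: nearW => n uv uv' uu; case: no; rewrite uv uv' uu.
  have : \forall n \near \oo, [disjoint hits flip pi n (arc u v) 0 (1 / 3) &
              hits flip pi n (arc u' v') 0 (1 / 3)]%B.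
    apply: (hits_sep pi_quot) => //; try exact: arcc; try lra.
    move=> t t' /andP[a b] /andP[a' b'] E.
    have [||E'|[_ _ E']] := meet _ _ _ _ _ _ uv uv' _ _ E; try lra.
    by rewrite E' eqxx in uu.
  by apply: filterS => n.
have sep2 : \forall n \near \oo, forall p : (G * G) * (G * G),
    adj p.1.1 p.1.2 -> adj p.2.1 p.2.2 -> p.2.1 != p.1.1 -> p.2.1 != p.1.2 ->
    [disjoint hits flip pi n (arc p.1.1 p.1.2) (1 / 3) (2 / 3) &
              hits flip pi n (arc p.2.1 p.2.2) 0 (1 / 3)]%B.
  apply: filter_forall => -[[u v] [u' v']] /=.
  have [/and4P[uv uv' n1 n2]|no] := pselect ([&& adj u v, adj u' v', u' != u & u' != v]); last first.
    by apply: nearW => n uv uv' n1 n2; case: no; rewrite uv uv' n1 n2.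
  have : \forall n \near \oo, [disjoint hits flip pi n (arc u v) (1 / 3) (2 / 3) &
              hits flip pi n (arc u' v') 0 (1 / 3)]%B.
    apply: (hits_sep pi_quot) => //; try exact: arcc; try lra.
    move=> t t' /andP[a b] /andP[a' b'] E.
    have [||E'|[E' _ _]] := meet _ _ _ _ _ _ uv uv' _ _ E; try lra.
    - by rewrite E' eqxx in n1.
    - by rewrite E' eqxx in n2.
  by apply: filterS => n.
have sep3 : \forall n \near \oo, forall p : (G * G) * (G * G),
    adj p.1.1 p.1.2 -> adj p.2.1 p.2.2 -> p.1 != p.2 -> p.1 != (p.2.2, p.2.1) ->
    [disjoint hits flip pi n (arc p.1.1 p.1.2) (1 / 3) (2 / 3) &
              hits flip pi n (arc p.2.1 p.2.2) (1 / 3) (2 / 3)]%B.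
  apply: filter_forall => -[[u v] [u' v']] /=.
  have [/and4P[uv uv' n1 n2]|no] := pselect ([&& adj u v, adj u' v',
      (u, v) != (u', v') & (u, v) != (v', u')]); last first.
    by apply: nearW => n uv uv' n1 n2; case: no; rewrite uv uv' n1 n2.
  have : \forall n \near \oo, [disjoint hits flip pi n (arc u v) (1 / 3) (2 / 3) &
              hits flip pi n (arc u' v') (1 / 3) (2 / 3)]%B.
    apply: (hits_sep pi_quot) => //; try exact: arcc; try lra.
    move=> t t' /andP[a b] /andP[a' b'] E.
    have := arc_arc _ _ _ _ _ _ uv uv' _ _ E; rewrite !in_itv /=.
    have -> : (0 < t < 1) by apply/andP; split; lra.
    have -> : (0 < t' < 1) by apply/andP; split; lra.
    case/(_ isT isT)/set2_inj => -[E1 E2].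
      by rewrite E1 E2 eqxx in n1.
    by rewrite E1 E2 eqxx in n2.
  by apply: filterS => n.
have [n [s1 [s2 s3]]] := filter_ex (filterI sep1 (filterI sep2 sep3)).
exists n; apply: (@minor_of_fat _ _ _ _ _ (darts G) (B n) (P n)).
- exact: darts_sym.
- exact: darts_irr.
- move=> v g gE.
  have [c0 c0v] := @cell_cover _ _ _ _ pi_quot n (pt v).
  have toc0 x : x \in B n v -> g x = g c0.
    case/bigcupP => u vu xh.
    apply: (@hits_conn _ _ _ _ pi_quot n (arc v u) 0 (1 / 3)) => //; try lra.
    + exact: arcc.
    + by move=> e sh th; apply: gE; apply/bigcupP; exists u.
    + by apply/hitsP; exists 0; [lra|rewrite arc0].
  by move=> x y /toc0 -> /toc0 ->.
- move=> u v uv; apply/pred0P => c /=; apply: negbTE; apply/negP.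
  move=> /andP[/bigcupP[u' uu' cu] /bigcupP[v' vv' cv]].
  by have := disjointFr (s1 ((u, u'), (v, v')) uu' vv' uv) cu; rewrite cv.
- move=> u v; rewrite inE /= => uv; split.
  + by apply: (hits_conn pi_quot); [exact: arcc|lra|lra].
  + apply/set0Pn; have [c cx] := @cell_cover _ _ _ _ pi_quot n (arc u v (1 / 3)).
    exists c; rewrite inE; apply/andP; split; first by apply/hitsP; exists (1 / 3) => //; lra.
    by apply/bigcupP; exists v => //; apply/hitsP; exists (1 / 3) => //; lra.
  + apply/set0Pn; have [c cx] := @cell_cover _ _ _ _ pi_quot n (arc u v (2 / 3)).
    exists c; rewrite inE; apply/andP; split; first by apply/hitsP; exists (2 / 3) => //; lra.
    apply/bigcupP; exists u; first by rewrite adj_sym.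
    apply/hitsP; exists (1 / 3); first by lra.
    rewrite arcV //; last by lra.
    by have -> : 1 - 1 / 3 = 2 / 3 :> K by lra.
- move=> u v w; rewrite inE /= => uv wu wv; apply/pred0P => c /=; apply: negbTE; apply/negP.
  move=> /andP[cu /bigcupP[x wx cx]].
  by have := disjointFr (s2 ((u, v), (w, x)) uv wx wu wv) cu; rewrite cx.
- move=> u v u' v'; rewrite !inE /= => uv uv' n1 n2.
  exact: (s3 ((u, v), (u', v'))).
Qed.

End Embedding.

(** * The torus and the Klein bottle as quotients of the plane *)

Section Quotients.
Variable K : realType.
Local Open Scope ring_scope.

Lemma torus_quotient :
  surface_quotient false (fun p : K * K => (\pi_(torus K) p)%qT : torus K).
Proof.
split.
- by move=> x; exists (repr x); rewrite reprK.
- exact: pi_continuous.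
- by [].
- move=> p q; split.
    move/eqmodP => /asboolP[m [j ->]]; exists m, j.
    by rewrite /act /= expr0 mul1r.
  case=> m [j ->]; apply/eqmodP/asboolP; exists m, j.
  by rewrite /act /= expr0 mul1r.
Qed.

Lemma expN1z_twist (m : int) : (-1) ^ m = (-1) ^+ twist true m :> K.
Proof.
rewrite /twist andTb; case: m => k; first by rewrite -exprnP signr_odd.
by rewrite NegzE abszN absz_nat -exprnN invr_sign signr_odd.
Qed.

Lemma klein_quotient :
  surface_quotient true (fun p : K * K => (\pi_(klein_bottle K) p)%qT : klein_bottle K).
Proof.
split.
- by move=> x; exists (repr x); rewrite reprK.
- exact: pi_continuous.
- by [].
- move=> p q; split.
    move/eqmodP => /asboolP[m [j ->]]; exists m, j.
    by rewrite /act /= expN1z_twist.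
  case=> m [j ->]; apply/eqmodP/asboolP; exists m, j.
  by rewrite /act /= expN1z_twist.
Qed.

End Quotients.


Theorem theorem3 (K : realType) (G : sgraph) (R : {set {set G}})
    (G_emb : embeddable K G (torus K) \/ embeddable K G (klein_bottle K))
    (R_edges : R \subset edges G)
    (no_346 : forall c : seq G, is_cycle c ->
       [/\ Rlength R c <> 3, Rlength R c <> 4 & Rlength R c <> 6])
    (no_55 : forall c1 c2 : seq G, is_cycle c1 -> is_cycle c2 ->
       Rlength R c1 = 5 -> Rlength R c2 = 5 ->
       #|cycle_edges c1 :&: cycle_edges c2| <> 1)
    (C : choiceType) (L : G -> {fset C})
    (L5 : forall v : G, #|` L v| = 5) :
  exists f : G -> C,
    [/\ forall v : G, f v \in L v,
        forall u v : G, adj u v -> f u <> f v &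
        forall v : G, ~~ relaxed R v ->
          exists c : C, odd #|[set u in nbhd v | f u == c]|].
Proof.
have [flip [n mA]] : exists flip n, minor_model (@gsrc n) (@gtgt n flip) (darts G).
  case: G_emb => emb.
    by exists false; have := embedding_minor (torus_quotient K) emb.
  by exists true; have := embedding_minor (klein_quotient K) emb.
have [f [fL fp fo]] := odd_colouring_exists L5 (grid_complex n flip) (@darts_sym G)
  (@darts_irr G) (Rdarts_sub R_edges) (@Rdarts_sym G R)
  (cycles_sparse no_346 no_55) mA.
exists f; split => // [u v uv|v]; first by apply: fp; rewrite inE.
rewrite (relaxedE R_edges) => /fo[c oc]; exists c.
by have -> : nbhd v = dnbr (darts G) v by apply/setP => u; rewrite !inE.
Qed.
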